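(* For each $n\ge1$ let $T_1,\dots,T_n$ be i.i.d. uniform on $[0,1]$, $N^{(n)}(t):=\sum_{i=1}^n\mathbf 1\{T_i\le t\}$ and $\tau^{(n)}_k:=\inf\{t:N^{(n)}(t)\ge k\}$. Let $(\dot X^{(n)}_k)_{k=0}^n$ be a real stochastic process independent of $(N^{(n)}(t))_{t\in[0,1]}$, and let $X^{(n)}(t):=\dot X^{(n)}_{N^{(n)}(t)}$, $t\in[0,1]$ (so $\dot X^{(n)}_k=X^{(n)}(\tau^{(n)}_k)$). Let $a_n,b_n>0$, let $f$ be continuously differentiable on $[0,1]$ (differentiable on $(0,1)$ with $f'$ extending continuously to $[0,1]$), and let $(Z(t),W(t))_{t\in[0,1]}$ be a continuous 2-dimensional Gaussian process such that in $D[0,1]$ \[ \Big(a_n\big(X^{(n)}(t)-b_nf(t)\big),\ n^{-1/2}\big(N^{(n)}(t)-nt\big)\Big)\xrightarrow{d}(Z(t),W(t)). \] Suppose $n^{-1/2}a_nb_n\to c\in[0,\infty)$. Then in $D[0,1]$ \[ a_n\big(\dot X^{(n)}_{\lfloor nt\rfloor}-b_nf(t)\big)\xrightarrow{d}\dot Z(t):=Z(t)-cf'(t)W(t), \] and $\dot Z$ is a continuous Gaussian process with $\mathbb E\dot Z(t)=\mathbb EZ(t)$ and \[ \operatorname{Cov}(\dot Z(s),\dot Z(t))=\operatorname{Cov}(Z(s),Z(t))-c^2s(1-t)f'(s)f'(t),\qquad 0\le s\le t\le1. \]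
   Context: $D[0,1]$ is the space of càdlàg functions on $[0,1]$ (vector-valued for joint convergence) with the Skorohod topology. *)

(* Defs.v *)
From HB Require Import structures.
From mathcomp Require Import all_boot all_order all_algebra.
From mathcomp Require Import all_classical all_reals all_analysis.
Set Implicit Arguments. Unset Strict Implicit. Unset Printing Implicit Defensive.
Import Order.TTheory GRing.Theory Num.Theory.
Import numFieldNormedType.Exports.
Local Open Scope classical_set_scope.
Local Open Scope ring_scope.

(* Paths are functions R -> V; only their values on [0,1] matter. *)

Definition cadlag {R : realType} {V : normedModType R} (x : R -> V) : Prop :=
  (forall t, 0 <= t < 1 -> x @ at_right t --> x t) /\
  (forall t, 0 < t <= 1 -> cvg (x @ at_left t)).

Definition time_change {R : realType} (l : R -> R) : Prop :=
  l 0 = 0 /\ l 1 = 1 /\ {within `[0, 1], continuous l} /\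
  {in `[0, 1] &, forall s t, s < t -> l s < l t}.

(** [skorohod_close x y d]: J1-distance between x and y (on [0,1]) is < d,
    up to the usual sup/strict-inequality slack; these sets form a
    neighbourhood basis of the Skorohod J1 topology. *)
Definition skorohod_close {R : realType} {V : normedModType R}
  (x y : R -> V) (d : R) : Prop :=
  exists l, time_change l /\
    forall t, 0 <= t <= 1 -> `|l t - t| < d /\ `|x t - y (l t)| < d.

Definition skorohod_continuous {R : realType} {V : normedModType R}
  (F : (R -> V) -> R) : Prop :=
  forall x, cadlag x -> forall e, 0 < e -> exists2 d, 0 < d &
    forall y, cadlag y -> skorohod_close x y d -> `|F x - F y| < e.

Definition cvg_dist_D {R : realType} {V : normedModType R}
  (dn : nat -> measure_display) (Om : forall n, measurableType (dn n))
  (P : forall n, probability (Om n) R) (X : forall n, Om n -> R -> V)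
  (d0 : measure_display) (Om0 : measurableType d0) (P0 : probability Om0 R)
  (Y : Om0 -> R -> V) : Prop :=
  forall F : (R -> V) -> R, (exists M, forall x, `|F x| <= M) ->
    skorohod_continuous F ->
    (fun n => (\int[P n]_w (F (X n w))%:E)%E) @ \oo -->
      (\int[P0]_w (F (Y w))%:E)%E.

Definition gaussian_rv {R : realType} d (Om : measurableType d)
  (P : probability Om R) (Y : Om -> R) : Prop :=
  exists m s : R,
    (s = 0 /\ forall A, measurable A -> P (Y @^-1` A) = \d_m A) \/
    (0 < s /\ forall A, measurable A -> P (Y @^-1` A) = normal_prob m s A).

Definition gaussian_process {R : realType} d (Om : measurableType d)
  (P : probability Om R) (Z : R -> Om -> R) : Prop :=
  (forall t, 0 <= t <= 1 -> measurable_fun setT (Z t)) /\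
  forall s : seq (R * R), all (fun p => (0 <= p.1 <= 1)) s ->
    gaussian_rv P (fun w => \sum_(p <- s) p.2 * Z p.1 w).

Definition gaussian_process2 {R : realType} d (Om : measurableType d)
  (P : probability Om R) (Z W : R -> Om -> R) : Prop :=
  (forall t, 0 <= t <= 1 -> measurable_fun setT (Z t)) /\
  (forall t, 0 <= t <= 1 -> measurable_fun setT (W t)) /\
  forall s : seq (R * (R * R)), all (fun p => (0 <= p.1 <= 1)) s ->
    gaussian_rv P (fun w => \sum_(p <- s) (p.2.1 * Z p.1 w + p.2.2 * W p.1 w)).

Definition as_continuous {R : realType} {V : normedModType R} d
  (Om : measurableType d) (P : probability Om R) (X : Om -> R -> V) : Prop :=
  {ae P, forall w, {within `[0, 1], continuous (X w)}}.

Definition mutually_independent {R : realType} d (Om : measurableType d)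
  (P : probability Om R) (n : nat) (T : 'I_n -> Om -> R) : Prop :=
  forall B : 'I_n -> set R, (forall i, measurable (B i)) ->
    P (\bigcap_(i in [set: 'I_n]) (T i @^-1` B i)) =
    (\prod_(i < n) P (T i @^-1` B i))%E.

Definition independent_families {R : realType} d (Om : measurableType d)
  (P : probability Om R) (I J : Type) (X : I -> Om -> R) (Y : J -> Om -> R)
  : Prop :=
  forall (s1 : set I) (s2 : set J) (A : I -> set R) (B : J -> set R),
    finite_set s1 -> finite_set s2 ->
    (forall i, measurable (A i)) -> (forall j, measurable (B j)) ->
    P ((\bigcap_(i in s1) (X i @^-1` A i)) `&`
       (\bigcap_(j in s2) (Y j @^-1` B j))) =
    (P (\bigcap_(i in s1) (X i @^-1` A i)) *
     P (\bigcap_(j in s2) (Y j @^-1` B j)))%E.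

Definition uniform01 {R : realType} d (Om : measurableType d)
  (P : probability Om R) (T : Om -> R) : Prop :=
  measurable_fun setT T /\
  forall B, measurable B -> P (T @^-1` B) = lebesgue_measure (B `&` `[0, 1]).

Definition count_proc {R : realType} {Om : Type} (n : nat) (T : 'I_n -> Om -> R)
  (t : R) (w : Om) : nat := (\sum_(i < n) nat_of_bool (T i w <= t)%R)%N.

(* Main.v *)
Require Import Defs.
From HB Require Import structures.
From mathcomp Require Import all_boot all_order all_algebra.
From mathcomp Require Import all_classical all_reals all_analysis.
From mathcomp Require Import measurable_realfun ring lra.
Import Order.TTheory GRing.Theory Num.Theory.
Import numFieldNormedType.Exports.
Local Open Scope classical_set_scope.
Local Open Scope ring_scope.

(** Write [x_n], [w_n] for the two components of the given pair and [h(x, w) := x - c f' w].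
    If [N] takes every value in [0..n] (there are no ties, almost surely), then
    [floor (n t) = N s] for some [s] with [s - t = - w_n(s) / sqrt n + O(1/n)], and the
    mean value theorem shows that the centered embedded chain [y_n] stays within the
    oscillation of [(x_n, w_n)] of [h(x_n, w_n)], surely and without any tightness
    argument, as soon as [w_n] is bounded and [n] is large.  A bounded J1-continuous [F]
    evaluated at [y_n] is then dominated by the m-Lipschitz J1-envelope of this relation
    evaluated at [(x_n, w_n)], to which the hypothesis applies; since the limit has continuous
    paths the envelopes decrease to [F (h (Z, W))] as [m] grows, and the same argument for
    [M - F] gives the lower bound.

    The same mapping principle transfers truncated moments.  The fourth moments of [w_n] are
    bounded, so [W] has the mean and covariance of a Brownian bridge; [y_n] is independent of
    [N], so [h (Z, W)] is uncorrelated with [W], whence the covariance formula. *)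

(** * Paths on [0,1] and the Skorohod distance *)

(** The test functional [F] is only assumed J1-continuous, so [F] along a random path need not be
    measurable. The integral of a nonnegative function is then a lower integral, monotone but in
    general not additive. Hence the bracketing between two envelopes: on the prelimit side it uses
    monotonicity alone, and measurability is needed only along the continuous limit paths, where
    sampling on a grid provides it. The passage from [(x_n, w_n)] to [y_n] depends on [n], so a
    relation between paths takes the place of one continuous map.

    No moment bound is available for [x_n] or [y_n]. The products with [w_n] are therefore
    truncated, the independence of [y_n] and [N] is passed to the limit at each truncation level,
    and the level is removed afterwards, where Gaussian variables are square integrable. Finally
    [Z = Zd + c f' W], and the cross moments of [Zd] and [W] vanish, so the two covariances differ
    exactly by that of [c f' W]. *)

Definition unif_cont01 {R : realType} {V : normedModType R} (x : R -> V) :=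
  forall e, 0 < e -> exists2 d, 0 < d &
    forall s t, 0 <= s <= 1 -> 0 <= t <= 1 -> `|s - t| < d -> `|x s - x t| < e.

Lemma within01_continuousP {R : realType} {V : normedModType R} (x : R -> V) :
  {within `[0, 1], continuous x} <->
  forall t, 0 <= t <= 1 -> forall e, 0 < e -> exists2 d, 0 < d &
    forall s, 0 <= s <= 1 -> `|t - s| < d -> `|x t - x s| < e.
Proof.
rewrite subspace_continuousP; split=> [xc t t01 e e0|xc t /= t01].
  have /cvgrPdist_lt /(_ _ e0) := xc t ltac:(by rewrite /= in_itv).
  move=> [d /= d0 dU]; exists d => // s s01 ts.
  by apply: dU => //=; rewrite in_itv.
apply/cvgrPdist_lt => e e0; move: t01; rewrite in_itv/= => t01.
have [d d0 dP] := xc _ t01 _ e0.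
by exists d => //= s ts; rewrite in_itv/= => s01; exact: dP.
Qed.

(** Heine-Cantor: compactness in near-covering form replaces the pointwise radii by one radius,
    taken along the filter of small positive reals. *)
Lemma within01_unif_cont {R : realType} {V : normedModType R} (x : R -> V) :
  {within `[0, 1], continuous x} -> unif_cont01 x.
Proof.
move=> /within01_continuousP xc e e0.
have /compact_near_coveringP := @segment_compact R 0 1.
move=> /(_ R 0^'+ (fun d s => forall t, 0 <= s <= 1 -> 0 <= t <= 1 ->
  `|s - t| < d -> `|x s - x t| < e)) [].
  move=> t /=; rewrite in_itv/= => t01.
  have [d d0 dP] := xc t t01 (e / 2) ltac:(by rewrite divr_gt0).
  near=> s r => u s01 u01 su /=.
  have ts : `|t - s| < d / 2.
    near: s; exact: (@cvgr_dist_lt _ _ _ (nbhs t) _ id t (@cvg_id _ (nbhs t)) _ (divr_gt0 d0 (ltr0Sn _ 1))).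
  have rd : r < d / 2 by near: r; apply: nbhs_right_lt; rewrite divr_gt0.
  have h1 : `|x t - x s| < e / 2 by apply: dP => //; lra.
  have h2 : `|x t - x u| < e / 2.
    apply: dP => //; have := ler_normD (t - s) (s - u).
    rewrite addrA subrK; move: su rd ts => /=; lra.
  have -> : x s - x u = - (x t - x s) + (x t - x u).
    by rewrite opprB addrA subrK.
  by have := ler_normD (- (x t - x s)) (x t - x u); rewrite normrN => ?; lra.
move=> d /= d0 H; exists (d / 2); first by rewrite divr_gt0.
have d2 : 0 < d / 2 by rewrite divr_gt0.
have := H (d / 2); rewrite /= sub0r normrN gtr0_norm// => /(_ ltac:(lra) d2) H'.
by move=> s t s01 t01 st; apply: H' => //=; rewrite in_itv.
Unshelve. all: by end_near. Qed.

(** Inverse time changes make [skorohod_close] symmetric. The intermediate value theorem gives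
    preimages, strict monotonicity makes them unique, and the inverse of a continuous injection of a
    segment is continuous. *)
Lemma time_change_inv {R : realType} (l : R -> R) : time_change l ->
  exists l', [/\ time_change l',
    forall t, 0 <= t <= 1 -> 0 <= l' t <= 1,
    forall t, 0 <= t <= 1 -> l (l' t) = t &
    forall t, 0 <= t <= 1 -> 0 <= l t <= 1].
Proof.
move=> [l0 [l1 [lc lm]]].
have lr t : 0 <= t <= 1 -> 0 <= l t <= 1.
  move=> t01; have i0 : (0 : R) \in `[0, 1] by rewrite in_itv/= lexx ler01.
  have i1 : (1 : R) \in `[0, 1] by rewrite in_itv/= lexx ler01.
  have it : t \in `[0, 1] by rewrite in_itv.
  have [/andP[t0 t1]] := t01.
  move: t0 t1; rewrite le_eqVlt => /predU1P[<-|t0]; first by rewrite l0 lexx ler01.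
  rewrite le_eqVlt => /predU1P[->|t1]; first by rewrite l1 lexx ler01.
  by have := lm _ _ i0 it t0; have := lm _ _ it i1 t1; rewrite l0 l1 => *; lra.
have surj t : exists s, 0 <= t <= 1 -> (0 <= s <= 1 /\ l s = t).
  have [t01|nt] := boolP (0 <= t <= 1); last by exists 0.
  have [|s] := IVT (@ler01 R) lc (v := t); first by rewrite l0 l1 (min_idPl _) ?(max_idPr _).
  by rewrite in_itv/= => s01 <-; exists s.
have /choice [l' l'P] := surj.
exists l'; split=> //; first last.
- by move=> t /l'P[].
- by move=> t /l'P[].
have inj : {in `[0, 1], cancel l l'}.
  move=> s si; have s01 : 0 <= s <= 1 by move: si; rewrite in_itv.
  have [i e] := l'P _ (lr _ s01).
  have [/lm H|/lm H|//] := ltgtP (l' (l s)) s.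
    by have := H ltac:(by rewrite in_itv) si; rewrite e ltxx.
  by have := H si ltac:(by rewrite in_itv); rewrite e ltxx.
split; first by rewrite -[in l' 0]l0 inj// in_itv/= lexx ler01.
split; first by rewrite -[in l' 1]l1 inj// in_itv/= lexx ler01.
split.
  by have := segment_can_le_continuous (@ler01 R) lc inj; rewrite l0 l1.
have lmono s t : 0 <= s <= 1 -> 0 <= t <= 1 -> s <= t -> l s <= l t.
  move=> s01 t01; rewrite le_eqVlt => /predU1P[->//|/lm H].
  by apply/ltW/H; rewrite in_itv.
move=> s t; rewrite !in_itv/= => s01 t01 st.
have [h1 h2] := l'P _ s01; have [h3 h4] := l'P _ t01.
by rewrite ltNge; apply/negP => /(lmono _ _ h3 h1); rewrite h2 h4 leNgt st.
Qed.

Lemma time_change_comp {R : realType} (l m : R -> R) :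
  time_change l -> time_change m -> time_change (l \o m).
Proof.
move=> hl hm; have [_ [_ _ _ mr]] := time_change_inv _ hm.
move: hl hm => [l0 [l1 [lc lm]]] [m0 [m1 [mc mm]]].
split; first by rewrite /= m0.
split; first by rewrite /= m1.
split; last first.
  move=> s t s01 t01 st /=; apply: lm; last exact: mm.
    by move: s01; rewrite !in_itv/=; exact: mr.
  by move: t01; rewrite !in_itv/=; exact: mr.
apply/within01_continuousP => t t01 e e0.
move/within01_continuousP : lc => /(_ _ (mr _ t01) _ e0)[d d0 dP].
move/within01_continuousP : mc => /(_ _ t01 _ d0)[d' d'0 d'P].
by exists d' => // s s01 ts; apply: dP; [exact: mr|exact: d'P].
Qed.

Lemma time_change_id {R : realType} : time_change (@id R).
Proof.
split=> //; split=> //; split; last by move=> s t _ _.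
by apply/within01_continuousP => t _ e e0; exists e.
Qed.

Lemma skorohod_close_unif {R : realType} {V : normedModType R} (x y : R -> V) d :
  0 < d -> (forall t, 0 <= t <= 1 -> `|x t - y t| < d) -> skorohod_close x y d.
Proof.
move=> d0 H; exists id; split; first exact: time_change_id.
by move=> t t01; rewrite subrr normr0; split=> //; apply: H.
Qed.

Lemma skorohod_close_sym {R : realType} {V : normedModType R} (x y : R -> V) d :
  skorohod_close x y d -> skorohod_close y x d.
Proof.
move=> [l [lt lP]]; have [l' [l't l'r l'K lr]] := time_change_inv _ lt.
exists l'; split=> // t t01; have := lP _ (l'r _ t01); rewrite l'K// => -[? ?].
by rewrite distrC; split=> //; rewrite distrC.
Qed.

Lemma skorohod_close_trans {R : realType} {V : normedModType R}
  (x y z : R -> V) d d' :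
  skorohod_close x y d -> skorohod_close y z d' -> skorohod_close x z (d + d').
Proof.
move=> [l [lt lP]] [m [mt mP]]; have [_ [_ _ _ lr]] := time_change_inv _ lt.
exists (m \o l); split; first exact: time_change_comp.
move=> t t01 /=; have [h1 h2] := lP _ t01; have [h3 h4] := mP _ (lr _ t01); split.
  by have := ler_normD (m (l t) - l t) (l t - t); rewrite addrA subrK => ?; lra.
by have := ler_normD (x t - y (l t)) (y (l t) - z (m (l t)));
  rewrite addrA subrK => ?; lra.
Qed.

(** Around a continuous path the J1 topology is that of uniform convergence: a time change
    displacing points by less than the modulus of [x] changes the values of [x] by less than
    [e / 2]. Continuity of the limit pair is exploited through this fact. *)
Lemma unif_cont_skorohod_unif {R : realType} {V : normedModType R} (x : R -> V) :
  unif_cont01 x -> forall e, 0 < e -> exists2 d, 0 < d &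
    forall y, skorohod_close x y d -> forall t, 0 <= t <= 1 -> `|x t - y t| < e.
Proof.
move=> xc e e0; have [d d0 dP] := xc (e / 2) ltac:(by rewrite divr_gt0).
exists (Num.min d (e / 2)); first by rewrite lt_min d0 divr_gt0.
move=> y /skorohod_close_sym[l [lt lP]] t t01.
have [_ [_ _ _ lr]] := time_change_inv _ lt.
have [] := lP _ t01; rewrite !lt_min => /andP[h1 _] /andP[_ h2].
have := dP _ _ (lr _ t01) t01 h1.
have -> : x t - y t = - (x (l t) - x t) - (y t - x (l t)).
  by rewrite !opprB addrA subrK.
have := ler_normB (- (x (l t) - x t)) (y t - x (l t)); rewrite normrN; lra.
Qed.

(** Walk from [0] to [t] in [k] equal steps, each shorter than the [d] attached to increments below
    1; [k] does not depend on [t]. *)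
Lemma unif_cont_bounded {R : realType} {V : normedModType R} (x : R -> V) :
  unif_cont01 x -> exists B, forall t, 0 <= t <= 1 -> `|x t| <= B.
Proof.
move=> /(_ _ ltr01)[d d0 dP].
have [k kd] : exists k : nat, d^-1 < k%:R.
  by exists (Num.bound d^-1); apply: archi_boundP; rewrite invr_ge0 ltW.
have k0 : 0 < k%:R :> R by apply: lt_trans kd; rewrite invr_gt0.
have kd1 : k%:R^-1 < d by rewrite invf_plt.
exists (`|x 0| + k%:R) => t t01.
suff H j : (j <= k)%N -> `|x (t * (j%:R / k%:R))| <= `|x 0| + j%:R.
  by have := H k (leqnn _); rewrite divff ?gt_eqF// mulr1.
have r01 i : (i <= k)%N -> 0 <= t * (i%:R / k%:R) <= 1.
  move=> ik; have [/andP[t0 t1]] := t01.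
  have i0 : 0 <= i%:R / k%:R :> R by rewrite divr_ge0.
  have i1 : i%:R / k%:R <= 1 :> R by rewrite ler_pdivrMr// mul1r ler_nat.
  by rewrite mulr_ge0//= mulr_ile1.
elim: j => [_|j IH jk]; first by rewrite mul0r mulr0 addr0.
have := dP _ _ (r01 _ jk) (r01 _ (ltnW jk)).
rewrite -mulrBr -mulrBl -natrB// subSnn mul1r.
have [/andP[t0 t1]] := t01.
have : `|t * k%:R^-1| < d.
  rewrite ger0_norm ?mulr_ge0// ?invr_ge0 1?ltW//.
  by apply: le_lt_trans kd1; rewrite ler_piMl// invr_ge0 ltW.
move=> h /(_ h) h1; have h2 := IH (ltnW jk).
have := ler_normD (x (t * (j.+1%:R / k%:R)) - x (t * (j%:R / k%:R))) (x (t * (j%:R / k%:R))).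
rewrite subrK -[j.+1]addn1 natrD in h1 *; lra.
Qed.

(** * Lipschitz envelopes and measurability of functionals *)

Section NonmeasurableIntegral.
Context {R : realType} {d : measure_display} {Om : measurableType d}.
Import HBNNSimple.

(* The integral of a non-measurable nonnegative function is its lower integral, which is monotone. *)
Lemma ge0_ae_le_integral_nonmeasurable (mu : {measure set Om -> \bar R})
  (f g : Om -> \bar R) :
  (forall x, 0 <= f x)%E -> (forall x, 0 <= g x)%E ->
  {ae mu, forall x, (f x <= g x)%E} ->
  (\int[mu]_x f x <= \int[mu]_x g x)%E.
Proof.
move=> f0 g0 [N [mN N0 fgN]]; rewrite !ge0_integralTE//.
apply: ge_ereal_sup => _ [h /= hf <-].
have mCN : measurable (~` N) by exact: measurableC.
(* The simple function below [f] is set to zero on the exceptional null set: it then lies below [g]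
   everywhere, and its integral is unchanged. *)
apply: ereal_sup_ubound => /=; exists (proj_nnsfun h mCN).
  move=> x /=; rewrite /mindic indicE; have [xN|xN] := boolP (x \in _).
    rewrite mulr1; apply: (le_trans (hf x)).
    move: xN; rewrite inE /= => xN; apply: contrapT => fgx.
    by apply: xN; apply: fgN.
  by rewrite mulr0.
rewrite -!integralT_nnsfun; apply: ae_eq_integral => //.
- exact/measurable_EFinP.
- exact/measurable_EFinP.
- exists N; split=> // x /= hx; apply: contrapT => xN; apply: hx => _.
  by rewrite /mindic indicE mem_set//= mulr1.
Qed.

Lemma ge0_ae_eq_integral_nonmeasurable (mu : {measure set Om -> \bar R})
  (f g : Om -> \bar R) :
  (forall x, 0 <= f x)%E -> (forall x, 0 <= g x)%E ->
  {ae mu, forall x, f x = g x} ->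
  (\int[mu]_x f x = \int[mu]_x g x)%E.
Proof.
move=> f0 g0 fg; apply/eqP; rewrite eq_le; apply/andP; split;
  apply: ge0_ae_le_integral_nonmeasurable => //.
- by apply: filterS fg => x ->.
- by apply: filterS fg => x ->.
Qed.

Lemma measurable_comp_countable (T : countType) (v : Om -> T) (g : T -> R) :
  (forall z, measurable [set w | v w = z]) ->
  measurable_fun setT (g \o v).
Proof.
move=> mv _ A mA; rewrite setTI.
have -> : (g \o v) @^-1` A =
    \bigcup_z (if `[< A (g z) >] then [set w | v w = z] else set0).
  apply/seteqP; split => [w /= Aw|w [z _]].
    by exists (v w) => //; case: asboolP.
  by case: asboolP => // Az /= ->.
apply: countable_bigcupT_measurable; first exact: countableP.
by move=> z; case: asboolP.
Qed.

End NonmeasurableIntegral.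

Section Envelope.
Context {R : realType} {V : normedModType R}.
Variables (M k : R) (Rel : (R -> V) -> R -> Prop).
Hypotheses (M0 : 0 <= M) (k0 : 0 <= k).

(** A sup-convolution: the value [r] is available at [q], and moving from [p] to [q] costs [k] times
    the J1 distance. The added [0] keeps the set nonempty, so that [sup] is a genuine least upper
    bound. *)
Definition envelope_set (p : R -> V) : set R :=
  [set 0] `|` [set v | exists r d q, [/\ 0 <= r <= M, 0 < d,
    skorohod_close p q d, Rel q r & v = r - k * d]].

(* The k-Lipschitz (for the J1 distance) upper envelope of the relation Rel, truncated at 0. *)
Definition envelope (p : R -> V) : R := sup (envelope_set p).

Lemma envelope_set_ub p : ubound (envelope_set p) M.
Proof.
move=> v [->//|[r [d [q [/andP[_ rM] d0 _ _ ->]]]]].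
have := mulr_ge0 k0 (ltW d0); lra.
Qed.

Lemma envelope_has_ub p : has_ubound (envelope_set p).
Proof. by exists M; exact: envelope_set_ub. Qed.

Lemma envelope_ge0 p : 0 <= envelope p.
Proof. by apply: ub_le_sup; [exact: envelope_has_ub|left]. Qed.

Lemma envelope_leM p : envelope p <= M.
Proof. by apply: ge_sup; [exists 0; left|exact: envelope_set_ub]. Qed.

Lemma envelope_ge p r : 0 <= r <= M -> Rel p r -> r <= envelope p.
Proof.
(* The radius has to be positive, so [q = p] only yields [r - k * d], with [d] then made small. The
   denominator [k + 1] allows for [k = 0]. *)
move=> rM Rr; apply/ler_addgt0Pr => e e0.
have k1 : 0 < k + 1 by rewrite ltr_wpDl.
have ek : 0 < e / (k + 1) by rewrite divr_gt0.
have : r - k * (e / (k + 1)) <= envelope p.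
  apply: ub_le_sup; first exact: envelope_has_ub.
  right; exists r, (e / (k + 1)), p; split => //.
  by apply: skorohod_close_unif => // t _; rewrite subrr normr0.
have : k * (e / (k + 1)) <= e.
  by rewrite mulrA ler_pdivrMr// mulrC ler_pM2l//; lra.
lra.
Qed.

(** Radii with [k * d > M] contribute only negative values, so competitors lie at J1 distance at
    most [M / k]. This localises the envelope at [p] as [k] grows. *)
Lemma envelope_le p B : 0 <= B ->
  (forall r d q, 0 <= r <= M -> 0 < d -> k * d <= M -> skorohod_close p q d ->
    Rel q r -> r <= B) -> envelope p <= B.
Proof.
move=> B0 H; apply: ge_sup; first by exists 0; left.
move=> v [->//|[r [d [q [rM d0 pq Rqr ->]]]]].
have kd0 := mulr_ge0 k0 (ltW d0).
have [kdM|kdM] := leP (k * d) M.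
  have := H _ _ _ rM d0 kdM pq Rqr; lra.
by have /andP[] := rM; lra.
Qed.

(** By the triangle inequality a competitor for [p'] at radius [d] is one for [p] at radius
    [e + d]. *)
Lemma envelope_lip p p' e : 0 < e -> skorohod_close p p' e ->
  envelope p' - k * e <= envelope p.
Proof.
move=> e0 pp'; rewrite lerBlDr; apply: ge_sup; first by exists 0; left.
have ke0 := mulr_ge0 k0 (ltW e0).
move=> v [->|[r [d [q [rM d0 pq Rqr ->]]]]].
  have := envelope_ge0 p; lra.
rewrite -lerBlDr; apply: ub_le_sup; first exact: envelope_has_ub.
right; exists r, (e + d), q; split=> //; first by lra.
  exact: skorohod_close_trans pp' pq.
by ring.
Qed.

Lemma envelope_continuous p e : 0 < e -> exists2 d, 0 < d &
  forall q, skorohod_close p q d -> `|envelope p - envelope q| < e.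
Proof.
move=> e0; have k1 : 0 < k + 1 by rewrite ltr_wpDl.
have ek : 0 < e / (k + 1) by rewrite divr_gt0.
exists (e / (k + 1)) => // q pq.
have := envelope_lip _ _ _ ek pq.
have := envelope_lip _ _ _ ek (skorohod_close_sym _ _ _ pq).
have : k * (e / (k + 1)) < e.
  by rewrite mulrA ltr_pdivrMr// mulrC ltr_pM2l//; lra.
rewrite ltr_norml => *; apply/andP; split; lra.
Qed.

End Envelope.

Section MeasurableFunctional.
Context {R : realType} {d : measure_display} {Om : measurableType d}.
Variables (p : Om -> R -> (R * R)) (G : (R -> (R * R)) -> R).
Hypothesis p1m : forall t : R, 0 <= t <= 1 -> measurable_fun setT (fun w => (p w t).1).
Hypothesis p2m : forall t : R, 0 <= t <= 1 -> measurable_fun setT (fun w => (p w t).2).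
Hypothesis pc : forall w, unif_cont01 (p w).
Hypothesis Gc : forall (x : R -> (R * R)) (e : R), 0 < e -> exists2 d : R, 0 < d &
  forall y : R -> (R * R), skorohod_close x y d -> `|G x - G y| < e.

(* Integer codes of the rounded values of a path on the grid of mesh 1/(L+1);
   they take countably many values. *)
Let code (L : nat) (w : Om) : {ffun 'I_L.+2 -> int * int} :=
  [ffun i : 'I_L.+2 => (Num.floor (L.+1%:R * (p w (i%:R / L.+1%:R)).1),
                        Num.floor (L.+1%:R * (p w (i%:R / L.+1%:R)).2))].

(** The index reaches [L.+1] at [t = 1], which is why the grid has [L.+2] points. *)
Let decode (L : nat) (z : {ffun 'I_L.+2 -> int * int}) (t : R) : R * R :=
  let v := z (inord (Num.truncn (L.+1%:R * t))) in
  (v.1%:~R / L.+1%:R, v.2%:~R / L.+1%:R).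

Let grid01 (L : nat) (i : 'I_L.+2) : 0 <= (i%:R / L.+1%:R : R) <= 1.
Proof.
rewrite divr_ge0//= ler_pdivrMr ?ltr0n// mul1r ler_nat.
by have := ltn_ord i.
Qed.

Let code_measurable L z : measurable [set w | code L w = z].
Proof.
have mfl (q : Om -> R) (u : int) : measurable_fun setT q ->
    measurable [set w | Num.floor (L.+1%:R * q w) = u].
  move=> mq.
  have mq' : measurable_fun setT (fun w => L.+1%:R * q w) by apply: measurable_funM => //; exact: measurable_cst.
  have -> : [set w | Num.floor (L.+1%:R * q w) = u] =
     setT `&` (fun w => L.+1%:R * q w) @^-1` [set` `[u%:~R, (u + 1)%:~R[].
    rewrite setTI; apply/seteqP; split=> w /=; rewrite in_itv/=.
      by move=> <-; exact: floor_itv.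
    by move=> H; apply/eqP; rewrite floor_eq.
  exact: mq'.
have -> : [set w | code L w = z] = \bigcap_(i in [set: 'I_L.+2])
    ([set w | Num.floor (L.+1%:R * (p w (i%:R / L.+1%:R)).1) = (z i).1] `&`
     [set w | Num.floor (L.+1%:R * (p w (i%:R / L.+1%:R)).2) = (z i).2]).
  apply/seteqP; split=> [w /= <- i _/=|w H /=]; first by rewrite ffunE.
  apply/ffunP => i; rewrite ffunE; have [/= -> ->] := H i I.
  by case: (z i).
apply: fin_bigcap_measurable; first exact: finite_finset.
move=> i _; apply: measurableI; apply: mfl; [exact: p1m|exact: p2m].
Qed.

Let decode_code_close L w e dd : (forall s t, 0 <= s <= 1 -> 0 <= t <= 1 ->
   `|s - t| < dd -> `|p w s - p w t| < e) -> L.+1%:R^-1 < dd -> L.+1%:R^-1 < e ->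
  forall t, 0 <= t <= 1 -> `|p w t - decode L (code L w) t| < 2 * e.
Proof.
move=> H Ld Le t /[dup] t01 /andP[t0 t1].
have L0 : 0 < L.+1%:R :> R by rewrite ltr0n.
rewrite /decode /code ffunE /=; set j := Num.truncn _.
have /andP[j1 j2] : j%:R <= L.+1%:R * t < j.+1%:R by apply: truncn_itv; rewrite mulr_ge0.
have jL : (j < L.+2)%N.
  rewrite ltnS -(ler_nat R); apply: (le_trans j1).
  by rewrite ler_piMr// ltW.
rewrite inordK//.
set u := j%:R / _.
have u01 : 0 <= u <= 1 by exact: (grid01 L (Ordinal jL)).
have between (y v : R) : v <= y -> y < v + L.+1%:R^-1 -> `|y - v| < L.+1%:R^-1.
  by move: (L.+1%:R^-1) => h *; rewrite ltr_norml; apply/andP; split; lra.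
have tu : `|t - u| < dd.
  apply: lt_trans Ld; apply: between; first by rewrite ler_pdivrMr// mulrC.
  rewrite /u -[X in _ < _ + X]mul1r -mulrDl ltr_pdivlMr// mulrC.
  by move: j2; rewrite -[j.+1]addn1 natrD addrC.
have fl (y : R) : `|y - (Num.floor (L.+1%:R * y))%:~R / L.+1%:R| < e.
  apply: lt_trans Le; have /andP[f1 f2] := floor_itv (L.+1%:R * y).
  apply: between; first by rewrite ler_pdivrMr// (mulrC y).
  rewrite -[X in _ < _ + X]mul1r -mulrDl ltr_pdivlMr// (mulrC y).
  by move: f2; rewrite intrD.
have := H _ _ t01 u01 tu.
rewrite /Num.norm/= /Num.norm/= !gt_max => /andP[a1 a2].
have := fl (p w u).1; have := fl (p w u).2.
set A := _ / _; set B := _ / _.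
move=> b2 b1; apply/andP; split.
  have := ler_normD ((p w t).1 - (p w u).1) ((p w u).1 - B).
  rewrite addrA subrK; lra.
have := ler_normD ((p w t).2 - (p w u).2) ((p w u).2 - A).
rewrite addrA subrK; lra.
Qed.

(** No sigma-algebra on paths is involved. The decoded step paths take countably many values, so [G]
    of them is measurable whatever [G] is; they converge uniformly to the uniformly continuous path
    [p w], and continuity of [G] passes to the limit. *)
Lemma measurable_functional : measurable_fun setT (fun w => G (p w)).
Proof.
apply: (@measurable_fun_cvg _ _ _ _ (fun L w => G (decode L (code L w)))).
  move=> L; apply: (@measurable_comp_countable _ _ _ _ (code L) (G \o decode L)).
  exact: code_measurable.
move=> w _; apply/cvgrPdist_lt => e e0.
have [dd dd0 ddP] := Gc (p w) _ e0.
have [d1 d10 d1P] := pc w (dd / 2) ltac:(by rewrite divr_gt0).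
have m0 : 0 < Num.min d1 (dd / 2) by rewrite lt_min d10 divr_gt0.
near=> L; apply: ddP; apply: skorohod_close_unif => // t t01.
have : L.+1%:R^-1 < Num.min d1 (dd / 2).
  near: L; exact: (near_infty_natSinv_lt (PosNum m0)).
rewrite lt_min => /andP[l1 l2].
have := decode_code_close L w _ _ d1P l1 l2 t t01; lra.
Unshelve. all: by end_near. Qed.

End MeasurableFunctional.

(** * A mapping theorem for relations *)

Lemma cvge_near_lt {R : realType} (u : nat -> \bar R) (l a : \bar R) :
  (l < a)%E -> u @ \oo --> l -> \forall n \near \oo, (u n < a)%E.
Proof.
by move=> la /(_ [set x | x < a]%E (open_ereal_lt' la)).
Qed.

Lemma cvge_near_gt {R : realType} (u : nat -> \bar R) (l a : \bar R) :
  (a < l)%E -> u @ \oo --> l -> \forall n \near \oo, (a < u n)%E.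
Proof.
by move=> la /(_ [set x | a < x]%E (open_ereal_gt' la)).
Qed.

Section Mapping.
Context {R : realType} (dn : nat -> measure_display)
  (Om : forall n, measurableType (dn n)) (P : forall n, probability (Om n) R)
  (X : forall n, Om n -> R -> (R * R)) (d0 : measure_display)
  (Om0 : measurableType d0) (P0 : probability Om0 R) (Y : Om0 -> R -> (R * R)).
Hypothesis XY : cvg_dist_D P X P0 Y.
Hypothesis Yc : as_continuous P0 Y.
Hypothesis Y1m : forall t : R, 0 <= t <= 1 -> measurable_fun setT (fun w => (Y w t).1).
Hypothesis Y2m : forall t : R, 0 <= t <= 1 -> measurable_fun setT (fun w => (Y w t).2).

(** Dominated convergence without a measurability assumption on [r0]: off a null set, [G m (Y w)]
    agrees with a measurable function, and [r0] with the pointwise limit of these. *)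
Lemma bounded_functional_integral_cvg (M : R) (G : nat -> (R -> (R * R)) -> R)
  (r0 : Om0 -> R) : 0 <= M ->
  (forall m p, 0 <= G m p <= M) -> (forall w, 0 <= r0 w <= M) ->
  (forall m (x : R -> (R * R)) (e : R), 0 < e -> exists2 d : R, 0 < d &
     forall y : R -> (R * R), skorohod_close x y d -> `|G m x - G m y| < e) ->
  (forall w, unif_cont01 (Y w) -> (fun m => G m (Y w)) @ \oo --> r0 w) ->
  (fun m => (\int[P0]_w (G m (Y w))%:E)%E) @ \oo --> (\int[P0]_w (r0 w)%:E)%E.
Proof.
move=> M0 GM rM Gc Gr.
have [N [mN N0 NP]] := Yc.
have Yuc w : ~ N w -> unif_cont01 (Y w).
  move=> Nw; apply: within01_unif_cont; apply: contrapT => h; apply: Nw.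
  exact: NP.
(* Replacing the path by zero on the null set makes every path of [Y'] uniformly continuous, as
   [measurable_functional] demands. *)
pose Y' w := if w \in N then (fun=> (0, 0)) else Y w.
have Y'uc w : unif_cont01 (Y' w).
  rewrite /Y'; case: ifPn => [_|]; last by rewrite notin_setE => /Yuc.
  by move=> e e0; exists 1 => // s t _ _ _; rewrite subrr normr0.
have mNb : measurable_fun setT (fun w : Om0 => w \in N).
  apply: (measurable_fun_bool true); rewrite setTI.
  rewrite (_ : _ @^-1` _ = N)//.
  by apply/seteqP; split => w /=; [exact: set_mem|exact: mem_set].
have mG m : measurable_fun setT (fun w => G m (Y' w)).
  apply: measurable_functional; [| |exact: Y'uc|exact: Gc].
  - move=> t t01; rewrite /Y'.
    have -> : (fun w => ((if w \in N then fun=> (0, 0) else Y w) t).1) =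
      (fun w => if w \in N then cst 0 w else (Y w t).1).
      by apply/funext => w; case: ifP.
    by apply: measurable_fun_ifT => //; exact: Y1m.
  - move=> t t01; rewrite /Y'.
    have -> : (fun w => ((if w \in N then fun=> (0, 0) else Y w) t).2) =
      (fun w => if w \in N then cst 0 w else (Y w t).2).
      by apply/funext => w; case: ifP.
    by apply: measurable_fun_ifT => //; exact: Y2m.
pose g m w := if w \in N then 0 else G m (Y' w).
pose g0 w := if w \in N then 0 else r0 w.
have mg m : measurable_fun setT (g m) by apply: measurable_fun_ifT => //.
have gg0 w : (fun m => g m w) @ \oo --> g0 w.
  rewrite /g /g0 /Y'; case: ifPn => [_|]; first exact: cvg_cst.
  by rewrite notin_setE => /Yuc; exact: Gr.
have mg0 : measurable_fun setT g0.
  by apply: (@measurable_fun_cvg _ _ _ _ g) => // w _; exact: gg0.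
have aeN : {ae P0, forall w, ~ N w}.
  by exists N; split=> // w /= /contrapT.
have E1 m : (\int[P0]_w (G m (Y w))%:E = \int[P0]_w (g m w)%:E)%E.
  apply: ge0_ae_eq_integral_nonmeasurable.
  - by move=> w; rewrite lee_fin; have /andP[] := GM m (Y w).
  - by move=> w; rewrite lee_fin /g; case: ifP => // _; have /andP[] := GM m (Y' w).
  - apply: filterS aeN => w Nw.
    by rewrite /g /Y' memNset.
have E2 : (\int[P0]_w (r0 w)%:E = \int[P0]_w (g0 w)%:E)%E.
  apply: ge0_ae_eq_integral_nonmeasurable.
  - by move=> w; rewrite lee_fin; have /andP[] := rM w.
  - by move=> w; rewrite lee_fin /g0; case: ifP => // _; have /andP[] := rM w.
  - by apply: filterS aeN => w Nw; rewrite /g0 memNset.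
rewrite E2; under eq_fun do rewrite E1.
have [] // := @dominated_convergence _ _ _ P0 setT measurableT
  (fun m w => (g m w)%:E) (fun w => (g0 w)%:E) (cst M%:E).
- by move=> m; exact/measurable_EFinP.
- exact/measurable_EFinP.
- apply/aeW => w _; apply: cvg_EFin; last exact: gg0.
  exact: nearW.
- exact: finite_measure_integrable_cst.
- apply/aeW => w m _; rewrite /= lee_fin /g; case: ifP => _; first by rewrite normr0.
  by have /andP[a b] := GM m (Y' w); rewrite ger0_norm.
Qed.

(** [r n] need be neither a function of [X n] nor measurable. The envelopes [L m] and [U m] of
    [Rel m] are bounded J1-continuous functionals, so convergence in distribution applies to them;
    they bracket [r n] almost everywhere for large [n], and both tend to [r0] along continuous paths
    as [m] grows. *)
Theorem relational_mapping (M : R) (r : forall n, Om n -> R) (r0 : Om0 -> R)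
  (Rel : nat -> (R -> (R * R)) -> R -> Prop) : 0 <= M ->
  (forall n w, 0 <= r n w <= M) -> (forall w, 0 <= r0 w <= M) ->
  (forall m, \forall n \near \oo, {ae P n, forall w, Rel m (X n w) (r n w)}) ->
  (forall w, unif_cont01 (Y w) -> forall m, Rel m (Y w) (r0 w)) ->
  (forall w, unif_cont01 (Y w) -> forall e : R, 0 < e -> exists m0, forall m q (d s : R),
     (m0 <= m)%N -> 0 < d -> m%:R * d <= M -> skorohod_close (Y w) q d ->
     0 <= s <= M -> Rel m q s -> `|s - r0 w| <= e) ->
  (fun n => (\int[P n]_w (r n w)%:E)%E) @ \oo --> (\int[P0]_w (r0 w)%:E)%E.
Proof.
move=> M0 rM r0M Xr Yr Yrc.
(* The reflection [s |-> M - s] turns an upper envelope into the lower one. *)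
pose Rel' m q s := Rel m q (M - s).
pose U m := envelope M m%:R (Rel m).
pose L m q := M - envelope M m%:R (Rel' m) q.
have k0 m : 0 <= m%:R :> R by [].
have UM m p : 0 <= U m p <= M by rewrite envelope_ge0//= envelope_leM.
have LM m p : 0 <= L m p <= M.
  by rewrite subr_ge0 envelope_leM//= lerBlDr lerDl envelope_ge0.
have Uc m (x : R -> (R * R)) (e : R) : 0 < e -> exists2 d : R, 0 < d &
     forall y : R -> (R * R), skorohod_close x y d -> `|U m x - U m y| < e.
  exact: envelope_continuous.
have Lc m (x : R -> (R * R)) (e : R) : 0 < e -> exists2 d : R, 0 < d &
     forall y : R -> (R * R), skorohod_close x y d -> `|L m x - L m y| < e.
  move=> e0; have [d dd H] := envelope_continuous M m%:R (Rel' m) M0 (k0 m) x e e0.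
  exists d => // y /H; rewrite -normrN; congr (`|_| < _).
  by rewrite /L; ring.
have Ur w : unif_cont01 (Y w) -> (fun m => U m (Y w)) @ \oo --> r0 w.
  move=> Yw; apply/cvgrPdist_le => e e0.
  have [m0 H] := Yrc w Yw e e0.
  exists m0 => // m /= m0m.
  have h1 : r0 w <= U m (Y w) by apply: envelope_ge => //; exact: Yr.
  have h2 : U m (Y w) <= r0 w + e.
    apply: envelope_le => //; first by have /andP[] := r0M w; lra.
    move=> s d q sM dd mdM cl rel; have := H m q d s m0m dd mdM cl sM rel.
    rewrite ler_norml; lra.
  by rewrite ler_norml; apply/andP; split; lra.
have Lr w : unif_cont01 (Y w) -> (fun m => L m (Y w)) @ \oo --> r0 w.
  move=> Yw; apply/cvgrPdist_le => e e0.
  have [m0 H] := Yrc w Yw e e0.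
  exists m0 => // m /= m0m; rewrite /L.
  have r0w : 0 <= M - r0 w <= M by have := r0M w; lra.
  have h1 : M - r0 w <= envelope M m%:R (Rel' m) (Y w).
    by apply: envelope_ge => //; rewrite /Rel' opprB addrC subrK; exact: Yr.
  have h2 : envelope M m%:R (Rel' m) (Y w) <= M - r0 w + e.
    apply: envelope_le => //; first by have /andP[] := r0w; lra.
    move=> s d q sM dd mdM cl rel.
    have := H m q d (M - s) m0m dd mdM cl ltac:(lra) rel.
    rewrite ler_norml; lra.
  by rewrite ler_norml; apply/andP; split; lra.
have IU := bounded_functional_integral_cvg _ _ _ M0 UM r0M Uc Ur.
have IL := bounded_functional_integral_cvg _ _ _ M0 LM r0M Lc Lr.
have XU m : (fun n => (\int[P n]_w (U m (X n w))%:E)%E) @ \oo -->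
    (\int[P0]_w (U m (Y w))%:E)%E.
  apply: XY; first by exists M => x; have /andP[a b] := UM m x; rewrite ger0_norm.
  by move=> x _ e /(Uc m x)[d dd H]; exists d => // y _; exact: H.
have XL m : (fun n => (\int[P n]_w (L m (X n w))%:E)%E) @ \oo -->
    (\int[P0]_w (L m (Y w))%:E)%E.
  apply: XY; first by exists M => x; have /andP[a b] := LM m x; rewrite ger0_norm.
  by move=> x _ e /(Lc m x)[d dd H]; exists d => // y _; exact: H.
have Ifin : (\int[P0]_w (r0 w)%:E)%E \is a fin_num.
  rewrite ge0_fin_numE; last first.
    by apply: integral_ge0 => w _; rewrite lee_fin; have /andP[] := r0M w.
  apply: (@le_lt_trans _ _ (\int[P0]_w (cst M%:E w))%E).
    apply: ge0_ae_le_integral_nonmeasurable.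
    - by move=> w; rewrite lee_fin; have /andP[] := r0M w.
    - by move=> w; rewrite /= lee_fin.
    - by apply/aeW => w; rewrite lee_fin; have /andP[] := r0M w.
  rewrite integral_cst// lte_mul_pinfty//.
  by rewrite -ge0_fin_numE//; exact: fin_num_measure.
have rU m : \forall n \near \oo, (\int[P n]_w (r n w)%:E <= \int[P n]_w (U m (X n w))%:E)%E.
  near=> n; apply: ge0_ae_le_integral_nonmeasurable.
  - by move=> w; rewrite lee_fin; have /andP[] := rM n w.
  - by move=> w; rewrite lee_fin; have /andP[] := UM m (X n w).
  - have : {ae P n, forall w, Rel m (X n w) (r n w)} by near: n; exact: Xr.
    by apply: filterS => w rel; rewrite lee_fin; apply: envelope_ge.
have Lr' m : \forall n \near \oo, (\int[P n]_w (L m (X n w))%:E <= \int[P n]_w (r n w)%:E)%E.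
  near=> n; apply: ge0_ae_le_integral_nonmeasurable.
  - by move=> w; rewrite lee_fin; have /andP[] := LM m (X n w).
  - by move=> w; rewrite lee_fin; have /andP[] := rM n w.
  - have : {ae P n, forall w, Rel m (X n w) (r n w)} by near: n; exact: Xr.
    apply: filterS => w rel; rewrite lee_fin /L lerBlDr -lerBlDl.
    apply: envelope_ge => //; first by have := rM n w; lra.
    by rewrite /Rel' opprB addrC subrK.
rewrite -(fineK Ifin) in IU IL *.
set I0 := fine _ in IU IL *.
(* The index [m] is fixed first, from the integrals under [P0]; only then does [n] grow, because
   [XU] and [rU] are statements for a fixed [m]. *)
have up (e : R) : 0 < e -> \forall n \near \oo, (\int[P n]_w (r n w)%:E < (I0 + e)%:E)%E.
  move=> e0.
  have : \forall m \near \oo, (\int[P0]_w (U m (Y w))%:E < (I0 + e)%:E)%E.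
    by apply: (cvge_near_lt _ _ _ _ IU); rewrite lte_fin ltrDl.
  move=> /filter_ex[m Hm].
  have : \forall n \near \oo, (\int[P n]_w (U m (X n w))%:E < (I0 + e)%:E)%E.
    exact: (cvge_near_lt _ _ _ Hm (XU m)).
  by apply: filterS2 (rU m) => n; exact: le_lt_trans.
have lo (e : R) : 0 < e -> \forall n \near \oo, ((I0 - e)%:E < \int[P n]_w (r n w)%:E)%E.
  move=> e0.
  have : \forall m \near \oo, ((I0 - e)%:E < \int[P0]_w (L m (Y w))%:E)%E.
    by apply: (cvge_near_gt _ _ _ _ IL); rewrite lte_fin ltrBlDr ltrDl.
  move=> /filter_ex[m Hm].
  have : \forall n \near \oo, ((I0 - e)%:E < \int[P n]_w (L m (X n w))%:E)%E.
    exact: (cvge_near_gt _ _ _ Hm (XL m)).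
  by move=> H; apply: filterS2 H (Lr' m) => n; exact: lt_le_trans.
apply/fine_cvgP; split.
  near=> n; rewrite fin_numE; apply/andP; split; apply/negP => /eqP h.
    have : ((I0 - 1)%:E < \int[P n]_w (r n w)%:E)%E by near: n; exact: lo.
    by rewrite h ltNge leNye.
  have : (\int[P n]_w (r n w)%:E < (I0 + 1)%:E)%E by near: n; exact: up.
  by rewrite h ltNge leey.
apply/cvgrPdist_lt => e e0; near=> n.
have h1 : ((I0 - e)%:E < \int[P n]_w (r n w)%:E)%E by near: n; exact: lo.
have h2 : (\int[P n]_w (r n w)%:E < (I0 + e)%:E)%E by near: n; exact: up.
have hf : (\int[P n]_w (r n w)%:E)%E \is a fin_num.
  rewrite fin_numE; apply/andP; split; apply/negP => /eqP h.
    by move: h1; rewrite h ltNge leNye.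
  by move: h2; rewrite h ltNge leey.
move: h1 h2; rewrite -(fineK hf) !lte_fin /= ltr_norml; lra.
Unshelve. all: by end_near. Qed.

End Mapping.

(** * The shear (z, w) |-> z - c f' w *)

Lemma skorohod_close_le {R : realType} {V : normedModType R} (x y : R -> V) (d e : R) :
  d <= e -> skorohod_close x y d -> skorohod_close x y e.
Proof.
move=> de [l [lt lP]]; exists l; split=> // t /lP[h1 h2].
by split; [apply: lt_le_trans de|apply: lt_le_trans de].
Qed.

Lemma within01_cadlag {R : realType} {V : normedModType R} (x : R -> V) :
  {within `[0, 1], continuous x} -> cadlag x.
Proof.
move=> /within01_continuousP xc; split=> t t01.
  have t01' : 0 <= t <= 1 by have /andP[-> /ltW ->] := t01.
  apply/cvgrPdist_lt => e e0; have [d d0 dP] := xc t t01' e e0.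
  have /andP[t0 t1] := t01.
  have m0 : 0 < Num.min d (1 - t) by rewrite lt_min d0 subr_gt0.
  exists (Num.min d (1 - t)) => // s /=; rewrite lt_min => /andP[sd s1] ts.
  apply: dP => //; move: s1; rewrite distrC ger0_norm ?subr_ge0 1?ltW//; lra.
have t01' : 0 <= t <= 1 by have /andP[/ltW -> ->] := t01.
apply/cvg_ex; exists (x t).
apply/cvgrPdist_lt => e e0; have [d d0 dP] := xc t t01' e e0.
have /andP[t0 t1] := t01.
have m0 : 0 < Num.min d t by rewrite lt_min d0.
exists (Num.min d t) => // s /=; rewrite lt_min => /andP[sd s1] ts.
apply: dP => //; move: s1; rewrite ger0_norm ?subr_ge0 ?(ltW ts)//; lra.
Qed.

Section PathEstimates.
Context {R : realType}.
Variables (c B : R) (fp : R -> R).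
Hypotheses (c0 : 0 <= c) (B0 : 0 <= B).
Hypothesis fpB : forall t, 0 <= t <= 1 -> `|fp t| <= B.

Definition shear (p : R -> (R * R)) (t : R) : R^o := (p t).1 - c * fp t * (p t).2.

Definition osc_le (q : R -> (R * R)) (d v : R) := forall s t, 0 <= s <= 1 ->
  0 <= t <= 1 -> `|s - t| <= d -> `|q s - q t| <= v.

(* y stays close to the sheared path, up to the oscillation of q itself;
   nothing is required when q is large. *)
Definition shear_rel (m : nat) (q : R -> (R * R)) (y : R -> R^o) :=
  (forall t, 0 <= t <= 1 -> `|(q t).2| <= m.+1%:R) ->
  forall v, osc_le q m.+1%:R^-1 v ->
  forall t, 0 <= t <= 1 -> `|y t - shear q t| <= (1 + c * B) * v + m.+1%:R^-1.

Lemma shear_rel_refl m q : shear_rel m q (shear q).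
Proof.
move=> _ v ov t t01; rewrite subrr normr0 addr_ge0// ?invr_ge0// mulr_ge0//.
  by rewrite addr_ge0// mulr_ge0.
by have := ov t t t01 t01; rewrite !subrr !normr0; apply; rewrite invr_ge0.
Qed.

Lemma shear_lip p q t d : 0 <= t <= 1 -> `|q t - p t| <= d ->
  `|shear q t - shear p t| <= (1 + c * B) * d.
Proof.
move=> t01; rewrite prod_normE/= ge_max => /andP[h1 h2].
have -> : shear q t - shear p t =
  ((q t).1 - (p t).1) - c * (fp t * ((q t).2 - (p t).2)).
  by rewrite /shear; ring.
apply: (le_trans (ler_normB _ _)); rewrite mulrDl mul1r lerD//.
rewrite normrM ger0_norm// -mulrA ler_wpM2l// normrM.
by apply: ler_pM => //; exact: fpB.
Qed.

(** The constraint [m%:R * e <= M] forces [q] to be uniformly close to [p] for large [m]. Then [q]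
    is bounded by [m.+1%:R] and inherits a small oscillation from [p], so [shear_rel] becomes
    effective. The single index [m] serves as size bound, inverse time scale and inverse tolerance,
    so that one limit suffices. *)
Lemma shear_rel_close (p : R -> (R * R)) : unif_cont01 p -> forall (M d : R), 0 < d ->
  exists m0, forall m q (e : R), (m0 <= m)%N -> 0 < e -> m%:R * e <= M ->
    skorohod_close p q e -> forall y, shear_rel m q y ->
    (forall t, 0 <= t <= 1 -> `|y t - shear p t| < d) /\
    (forall t, 0 <= t <= 1 -> `|q t - p t| < d).
Proof.
move=> pc M d d0; have [A AP] := unif_cont_bounded _ pc.
pose C := 1 + c * B.
have C1 : 1 <= C by rewrite /C lerDl mulr_ge0.
have C0 : 0 < C by lra.
(* Budget: the oscillation [3 * d1] of [q] costs [C * (3 * d1)] and the shear of [q - p] costs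
   [C * d1], in total [d / 2]; the remainder [m.+1%:R^-1] is below [d / 2]. *)
pose d1 := d / (8 * C).
have d10 : 0 < d1 by rewrite divr_gt0// mulr_gt0.
have Cd1 : 8 * (C * d1) = d by rewrite mulrA /d1 mulrC divfK// gt_eqF// mulr_gt0.
have dd1 : d1 <= C * d1 by rewrite ler_peMl// ltW.
have [e1 e10 e1P] := unif_cont_skorohod_unif _ pc _ d10.
have [e2 e20 e2P] := pc _ d10.
have d20 : 0 < d / 2 by rewrite divr_gt0.
suff : \forall m \near \oo, forall q (e : R), 0 < e -> m%:R * e <= M ->
    skorohod_close p q e -> forall y, shear_rel m q y ->
    (forall t, 0 <= t <= 1 -> `|y t - shear p t| < d) /\
    (forall t, 0 <= t <= 1 -> `|q t - p t| < d).
  by move=> [m0 _ H]; exists m0 => m q e mm; apply: H.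
have big (x : R) : \forall m \near \oo, x < m%:R by exact: nbhs_infty_gtr.
near=> m => q e e0 meM cl y rel.
have m1 : 0 < m.+1%:R :> R by [].
have ee1 : e <= e1.
  have : M / e1 < m%:R by near: m; exact: big.
  rewrite ltr_pdivrMr// => Me; have := le_lt_trans meM Me.
  have [->|mn0] := eqVneq m 0%N; first by rewrite !mul0r ltxx.
  by rewrite ltr_pM2l ?ltr0n ?lt0n// => /ltW.
have qp t : 0 <= t <= 1 -> `|q t - p t| < d1.
  by rewrite distrC; exact: (e1P _ (skorohod_close_le _ _ _ _ ee1 cl)).
have inv_lt (x : R) : 0 < x -> x^-1 < m%:R -> m.+1%:R^-1 < x.
  move=> x0 xm; rewrite invf_plt ?posrE//; apply: (lt_trans xm).
  by rewrite ltr_nat.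
have me2 : m.+1%:R^-1 < e2 by apply: inv_lt => //; near: m; exact: big.
have md : m.+1%:R^-1 < d / 2 by apply: inv_lt => //; near: m; exact: big.
have q2m t : 0 <= t <= 1 -> `|(q t).2| <= m.+1%:R.
  move=> t01; have : A + d1 < m%:R by near: m; exact: big.
  have : m%:R <= m.+1%:R :> R by rewrite ler_nat.
  have := AP t t01; have := qp t t01.
  have : `|(q t).2| <= `|q t| by rewrite [leRHS]prod_normE le_max lexx orbT.
  have := ler_normD (q t - p t) (p t); rewrite subrK; lra.
have osc : osc_le q m.+1%:R^-1 (3 * d1).
  move=> s t s01 t01 st; have := e2P s t s01 t01 (le_lt_trans st me2).
  have := qp s s01; have := qp t t01; rewrite -(normrN (q t - p t)).
  have := ler_normD (q s - p s) (p s - p t).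
  have := ler_normD (q s - p t) (- (q t - p t)).
  rewrite opprB !addrA !subrK; lra.
split=> t t01; last by apply: (lt_le_trans (qp t t01)); lra.
have h1 := rel q2m _ osc t t01.
have h2 := shear_lip p q t d1 t01 (ltW (qp t t01)).
have -> : y t - shear p t = (y t - shear q t) + (shear q t - shear p t).
  by rewrite addrA subrK.
apply: (le_lt_trans (ler_normD _ _)); apply: (le_lt_trans (lerD h1 h2)).
rewrite -/C; have : C * (3 * d1) = 3 * (C * d1) by ring.
move: Cd1 dd1 md; move: (m.+1%:R^-1 : R) (C * d1) (C * (3 * d1)) => i X1 X2.
by clear; lra.
Unshelve. all: by end_near. Qed.

Lemma shear_unif_cont (p : R -> (R * R)) : {within `[0, 1], continuous fp} ->
  unif_cont01 p -> unif_cont01 (shear p).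
Proof.
move=> /within01_unif_cont fpc pc e e0; have [A AP] := unif_cont_bounded _ pc.
pose C := 1 + c * B.
have C1 : 1 <= C by rewrite /C lerDl mulr_ge0.
have C0 : 0 < C by lra.
have A0 : 0 <= A by apply: le_trans (AP 0 _); rewrite ?lexx ?ler01.
have A1 : 0 < c * A + 1 by rewrite ltr_wpDl// mulr_ge0.
have [d1 d10 d1P] := pc (e / 2 / C) ltac:(by rewrite !divr_gt0).
have [d2 d20 d2P] := fpc (e / 2 / (c * A + 1)) ltac:(by rewrite !divr_gt0).
exists (Num.min d1 d2); first by rewrite lt_min d10.
move=> s t s01 t01; rewrite lt_min => /andP[st1 st2].
have h1 := d1P _ _ s01 t01 st1; have h2 := d2P _ _ s01 t01 st2.
(* Freezing the path at the value [p s] separates the increment of [p], handled by [shear_lip], from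
   the increment of [fp]. *)
have -> : shear p s - shear p t =
    (shear (fun=> p s) t - shear p t) - c * ((fp s - fp t) * (p s).2).
  by rewrite /shear; ring.
apply: (le_lt_trans (ler_normB _ _)).
have k1 := shear_lip p (fun=> p s) t _ t01 (ltW h1).
rewrite -/C in k1.
have k2 : `|c * ((fp s - fp t) * (p s).2)| <= (c * A) * (e / 2 / (c * A + 1)).
  rewrite !normrM ger0_norm// -mulrA ler_wpM2l// mulrC ler_pM//; last exact: ltW.
  by apply: le_trans (AP s s01); rewrite [leRHS]prod_normE le_max lexx orbT.
have k3 : C * (e / 2 / C) = e / 2 by rewrite mulrC divfK// gt_eqF.
have k4 : (c * A) * (e / 2 / (c * A + 1)) < e / 2.
  rewrite mulrA ltr_pdivrMr// mulrC ltr_pM2l ?divr_gt0//.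
  by rewrite ltrDl.
rewrite k3 in k1; lra.
Qed.

Lemma skorohod_continuous_unif (F : (R -> R^o) -> R) (x : R -> R^o) (e : R) :
  skorohod_continuous F -> cadlag x -> 0 < e -> exists2 d : R, 0 < d &
    forall y : R -> R^o, cadlag y -> (forall t, 0 <= t <= 1 -> `|y t - x t| < d) ->
      `|F y - F x| <= e.
Proof.
move=> Fc xc e0; have [d d0 H] := Fc x xc e e0; exists d => // y yc yx.
rewrite distrC; apply/ltW/H => //; apply: skorohod_close_unif => // t t01.
by rewrite distrC; exact: yx.
Qed.

End PathEstimates.

Section ShearMapping.
Context {R : realType} (dn : nat -> measure_display)
  (Om : forall n, measurableType (dn n)) (P : forall n, probability (Om n) R)
  (X : forall n, Om n -> R -> (R * R)) (d0 : measure_display)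
  (Om0 : measurableType d0) (P0 : probability Om0 R) (Y : Om0 -> R -> (R * R)).
Hypothesis XY : cvg_dist_D P X P0 Y.
Hypothesis Yc : as_continuous P0 Y.
Hypothesis Y1m : forall t : R, 0 <= t <= 1 -> measurable_fun setT (fun w => (Y w t).1).
Hypothesis Y2m : forall t : R, 0 <= t <= 1 -> measurable_fun setT (fun w => (Y w t).2).
Variables (c B : R) (fp : R -> R) (y : forall n, Om n -> R -> R^o).
Hypotheses (c0 : 0 <= c) (B0 : 0 <= B).
Hypothesis fpB : forall t, 0 <= t <= 1 -> `|fp t| <= B.
Hypothesis fpc : {within `[0, 1], continuous fp}.
Hypothesis Xy : forall m, \forall n \near \oo, {ae P n, forall w,
  cadlag (y n w) /\ shear_rel c B fp m (X n w) (y n w)}.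

(** [K] sees both the embedded path and the pair, so that one mapping theorem serves functionals of
    the chain alone and products of coordinates of the two. Continuity is asked only at a continuous
    [p] paired with its shear, and only in uniform distance. *)
Definition shear_admissible (K : (R -> R^o) -> (R -> (R * R)) -> R) :=
  forall p, unif_cont01 p -> forall e : R, 0 < e -> exists2 d : R, 0 < d &
  forall x q, cadlag x -> (forall t, 0 <= t <= 1 -> `|x t - shear c fp p t| < d) ->
    (forall t, 0 <= t <= 1 -> `|q t - p t| < d) ->
    `|K x q - K (shear c fp p) p| <= e.

Lemma shear_cadlag p : unif_cont01 p -> cadlag (shear c fp p).
Proof.
move=> pc; apply: within01_cadlag; apply/within01_continuousP => t t01 e e0.
have [d dd H] := shear_unif_cont _ _ _ c0 B0 fpB _ fpc pc e e0.
by exists d => // s s01; exact: H.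
Qed.

Lemma ge0_shear_mapping (M : R) K : (forall x q, 0 <= K x q <= M) ->
  shear_admissible K ->
  (fun n => (\int[P n]_w (K (y n w) (X n w))%:E)%E) @ \oo -->
  (\int[P0]_w (K (shear c fp (Y w)) (Y w))%:E)%E.
Proof.
move=> KM Kc.
have M0 : 0 <= M by have /andP[a b] := KM (fun=> 0) (fun=> 0); exact: le_trans b.
(* The relation keeps only the number [K x q]; the embedded path [x] itself is quantified away. *)
apply: (relational_mapping _ _ _ X _ _ _ Y XY Yc Y1m Y2m M _ _
  (fun m q r => exists x, [/\ cadlag x, shear_rel c B fp m q x & r = K x q])) => //.
- move=> m; have := Xy m; apply: filterS => n; apply: filterS => w [h1 h2].
  by exists (y n w).
- move=> w Yw m; exists (shear c fp (Y w)); split => //.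
    exact: shear_cadlag.
  exact: shear_rel_refl.
- move=> w Yw e e0; have [d dd H] := Kc _ Yw e e0.
  have [m0 m0P] := shear_rel_close _ _ _ c0 B0 fpB _ Yw M d dd.
  exists m0 => m q d' s mm d'0 md cl _ [x [xc rel ->]].
  have [h1 h2] := m0P m q d' mm d'0 md cl x rel.
  exact: H.
Qed.

(* The integral of a non-measurable function is defined through its positive and negative parts. *)
Lemma shear_mapping (M : R) K : (forall x q, `|K x q| <= M) ->
  shear_admissible K ->
  (fun n => (\int[P n]_w (K (y n w) (X n w))%:E)%E) @ \oo -->
  (\int[P0]_w (K (shear c fp (Y w)) (Y w))%:E)%E.
Proof.
move=> KM Kc.
pose Kp x q := Num.max (K x q) 0; pose Kn x q := Num.max (- K x q) 0.
have KpM x q : 0 <= Kp x q <= M.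
  by have := KM x q; rewrite /Kp ler_norml; case: (leP (K x q) 0); lra.
have KnM x q : 0 <= Kn x q <= M.
  by have := KM x q; rewrite /Kn ler_norml; case: (leP (- K x q) 0); lra.
have max_lip (u v e : R) : `|u - v| <= e -> `|Num.max u 0 - Num.max v 0| <= e.
  by rewrite !ler_norml; case: (leP u 0); case: (leP v 0); lra.
have Kpc : shear_admissible Kp.
  move=> p pc e e0; have [d dd H] := Kc p pc e e0; exists d => // x q xc h1 h2.
  by apply: max_lip; exact: H.
have Knc : shear_admissible Kn.
  move=> p pc e e0; have [d dd H] := Kc p pc e e0; exists d => // x q xc h1 h2.
  by apply: max_lip; rewrite -opprD normrN; exact: H.
have Ip := ge0_shear_mapping M _ KpM Kpc.
have In := ge0_shear_mapping M _ KnM Knc.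
have E d (T : measurableType d) (Q : probability T R) (g : T -> R) :
  (\int[Q]_w (g w)%:E = \int[Q]_w (Num.max (g w) 0)%:E - \int[Q]_w (Num.max (- g w) 0)%:E)%E.
  rewrite integralE; congr (_ - _)%E; apply: eq_integral => w _.
    by rewrite funeposE EFin_max.
  by rewrite funenegE EFin_max.
under eq_fun do rewrite E; rewrite E.
apply: cvgeB => //.
apply: fin_num_adde_defl; rewrite fin_numN.
rewrite ge0_fin_numE; last first.
  by apply: integral_ge0 => w _; rewrite lee_fin; have /andP[] := KnM (shear c fp (Y w)) (Y w).
apply: (@le_lt_trans _ _ (\int[P0]_w (cst M%:E w))%E).
  apply: ge0_ae_le_integral_nonmeasurable.
  - by move=> w; rewrite lee_fin; have /andP[] := KnM (shear c fp (Y w)) (Y w).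
  - move=> w; rewrite /= lee_fin.
    by have /andP[a b] := KnM (shear c fp (Y w)) (Y w); exact: le_trans b.
  - by apply/aeW => w; rewrite lee_fin; have /andP[] := KnM (shear c fp (Y w)) (Y w).
rewrite integral_cst// lte_mul_pinfty//.
  rewrite lee_fin.
  by have /andP[a b] := KnM (fun=> 0) (fun=> 0); exact: le_trans b.
by rewrite -ge0_fin_numE//; exact: fin_num_measure.
Qed.

End ShearMapping.

(** * Counting paths and their embedded chain *)

Section CountingPaths.
Context {R : realType} {Om : Type} (n : nat) (T : 'I_n -> Om -> R) (w : Om).

Lemma count_proc_le t : (count_proc T t w <= n)%N.
Proof.
rewrite /count_proc -[X in (_ <= X)%N]card_ord -sum1_card.
by apply: leq_sum => i _; case: (_ <= _).
Qed.

(* Without ties the counting path takes every value in 0..n, so that each level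
   of the embedded chain is visited. *)
Lemma count_proc_surj : injective (T ^~ w) -> (forall i, 0 < T i w <= 1) ->
  forall k, (k <= n)%N -> exists2 s, 0 <= s <= 1 & count_proc T s w = k.
Proof.
move=> Tinj T01; elim=> [_|k IH kn].
  (* Level 0 is attained at time 0 because the sample points are strictly positive. *)
  exists 0; first by rewrite lexx ler01.
  apply: big1 => i _; have /andP[Ti _] := T01 i.
  by rewrite leNgt Ti.
have [s s01 sk] := IH (ltnW kn).
have [i0 si0] : exists i, s < T i w.
  apply: contrapT => h; move: kn; rewrite -sk /count_proc ltnNge.
  move=> /negP; apply; rewrite -[X in (X <= _)%N]card_ord -sum1_card.
  apply: leq_sum => i _; case: (leP (T i w) s) => // si.
  by exfalso; apply: h; exists i.
(* The first sample point after [s]: as there are no ties, exactly one more point is counted at that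
   time. *)
pose j := [arg min_(i < i0 | s < T i w) T i w]%O.
have [sj jmin] : s < T j w /\ forall i, s < T i w -> T j w <= T i w.
  by rewrite /j; case: Order.TotalTheory.arg_minP.
exists (T j w); first by have /andP[/ltW -> ->] := T01 j.
rewrite /count_proc (eq_bigr (fun i => ((T i w <= s)%R + (i == j))%N)).
  rewrite big_split /= -/(count_proc T s w) sk (bigD1 j)//= eqxx big1 ?addn0 ?addn1//.
  by move=> i /negbTE ->.
move=> i _; have [->|ij] := eqVneq i j; first by rewrite lexx leNgt sj.
rewrite addn0; have [Tis|sTi] := leP (T i w) s.
  by rewrite (le_trans Tis (ltW sj)).
have := jmin _ sTi; rewrite le_eqVlt => /predU1P[/Tinj/eqP|jTi].
  by rewrite eq_sym (negbTE ij).
by rewrite leNgt jTi.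
Qed.

End CountingPaths.

Section FloorPaths.
Context {R : realType}.
Variables (f fp : R -> R).
Hypothesis fc : {within `[0, 1], continuous f}.
Hypothesis fd : forall t, 0 < t < 1 -> derivable f t 1 /\ (f^`())%classic t = fp t.

Let mean_value_le s t : 0 <= s -> s <= t -> t <= 1 ->
  exists2 u, s <= u <= t & f t - f s = fp u * (t - s).
Proof.
move=> s0; rewrite le_eqVlt => /predU1P[->|st] t1.
  by exists t; rewrite ?lexx// !subrr mulr0.
have [||u] := @MVT R f fp s t st.
- move=> x; rewrite in_itv/= => /andP[sx xt].
  have [|h1 h2] := fd x; first by rewrite (le_lt_trans s0 sx) (lt_le_trans xt t1).
  by apply: DeriveDef => //; rewrite -derive1E.
- apply: continuous_subspaceW fc => x /=; rewrite !in_itv/= => /andP[sx xt].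
  by rewrite (le_trans s0 sx) (le_trans xt t1).
by rewrite in_itv/= => /andP[su ut] e; exists u => //; rewrite !ltW.
Qed.

Lemma mean_value01 s t : 0 <= s <= 1 -> 0 <= t <= 1 ->
  exists u, [/\ 0 <= u <= 1, `|u - t| <= `|s - t| & f s - f t = fp u * (s - t)].
Proof.
move=> /andP[s0 s1] /andP[t0 t1]; have [st|ts] := leP s t.
  have [u /andP[su ut] e] := mean_value_le s t s0 st t1; exists u; split.
  - by apply/andP; split; lra.
  - by rewrite !ler0_norm ?subr_le0//; lra.
  - by rewrite -opprB e; ring.
have [u /andP[su ut] e] := mean_value_le t s t0 (ltW ts) s1; exists u; split => //.
- by apply/andP; split; lra.
- by rewrite !ger0_norm ?subr_ge0 ?(ltW ts)//; lra.
Qed.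

Variables (c B : R).
Hypotheses (c0 : 0 <= c) (B0 : 0 <= B).
Hypothesis fpB : forall t, 0 <= t <= 1 -> `|fp t| <= B.

Definition floor_path (a b : R) (n : nat) (x : nat -> R) (t : R) : R^o :=
  a * (x (Num.truncn (n%:R * t)) - b * f t).

Definition counting_path (a b : R) (n : nat) (x : nat -> R) (N : R -> nat) (t : R) :=
  (a * (x (N t) - b * f t), ((N t)%:R - n%:R * t) / Num.sqrt n%:R).

(** The deterministic core. [D] bounds [|s - t|] once the normalized count is at most [m.+1%:R],
    [v0] bounds the variation of [fp] at scale [D], and the last hypothesis collects every error
    that vanishes as [n] grows with [m] fixed. *)
Lemma floor_path_shear_rel (a b : R) (n m : nat) x N (D v0 : R) :
  (0 < n)%N -> 0 < a -> 0 < b ->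
  (forall k, (k <= n)%N -> exists2 s, 0 <= s <= 1 & N s = k) ->
  D = m.+1%:R / Num.sqrt n%:R + n%:R^-1 ->
  D <= m.+1%:R^-1 ->
  (forall s t, 0 <= s <= 1 -> 0 <= t <= 1 -> `|s - t| <= D -> `|fp s - fp t| <= v0) ->
  `|a * b / Num.sqrt n%:R - c| * (B * m.+1%:R) + c * (v0 * m.+1%:R) +
    (a * b / Num.sqrt n%:R) * (B / Num.sqrt n%:R) <= m.+1%:R^-1 ->
  shear_rel c B fp m (counting_path a b n x N) (floor_path a b n x).
Proof.
move=> n0 a0 b0 Nsurj DE Dm fpD err qm v osc t t01.
have n0' : 0 < n%:R :> R by rewrite ltr0n.
pose r := Num.sqrt (n%:R : R).
have r0 : 0 < r by rewrite sqrtr_gt0.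
have rr : r * r = n%:R by rewrite -expr2 sqr_sqrtr// ltW.
have /andP[t0 t1] := t01.
have nt0 : 0 <= n%:R * t by rewrite mulr_ge0// ltW.
pose k := Num.truncn (n%:R * t).
have /andP[k1 k2] : k%:R <= n%:R * t < k.+1%:R by exact: truncn_itv.
have kn : (k <= n)%N.
  by rewrite -(ler_nat R); apply: (le_trans k1); rewrite ler_piMr// ltW.
have [s s01 Ns] := Nsurj k kn.
pose q := counting_path a b n x N.
pose ws := (q s).2; pose wt := (q t).2; pose th := n%:R * t - k%:R.
have th0 : 0 <= th by rewrite /th subr_ge0.
have th1 : th <= 1 by move: k2; rewrite /th -[k.+1]addn1 natrD; lra.
have wsE : ws * r = k%:R - n%:R * s by rewrite /ws /= Ns divfK// gt_eqF.
(* The normalized count at [s] measures the gap between [s] and [k / n]; [th] is the rounding error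
   of [n t], between 0 and 1. *)
have stE : s - t = - (ws / r) - th / n%:R.
  have : n%:R * (s - t) = n%:R * (- (ws / r) - th / n%:R).
    have -> : n%:R * (- (ws / r) - th / n%:R) = - (ws * r) - th.
      by rewrite -rr; field; rewrite gt_eqF.
    by rewrite wsE /th; ring.
  by apply: mulfI; rewrite gt_eqF.
have wsm : `|ws| <= m.+1%:R by exact: qm.
have stD : `|s - t| <= D.
  rewrite stE DE; apply: (le_trans (ler_normB _ _)); rewrite normrN.
  apply: lerD; first by rewrite normrM normfV (gtr0_norm r0) ler_pM2r// invr_gt0.
  by rewrite ger0_norm ?divr_ge0// ler_pdivrMr// mulVf// gt_eqF.
have [u [u01 ut fst]] := mean_value01 s t s01 t01.
have := osc s t s01 t01 (le_trans stD Dm).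
rewrite prod_normE/= ge_max => /andP[q1 q2].
pose cn := a * b / r.
(* An exact expansion: [cn] is replaced by [c], then [fp u] by [fp t], then [ws] by [wt], and the
   last term is the rounding. The increments of [q] give [(1 + c * B) * v]; the three other terms
   are absorbed by [err]. *)
have -> : floor_path a b n x t - shear c fp q t =
  ((q s).1 - (q t).1) - ((cn - c) * (fp u * ws) + c * ((fp u - fp t) * ws) +
    c * (fp t * (ws - wt)) + cn * (fp u * th / r)).
  have -> : floor_path a b n x t = (q s).1 + a * b * (f s - f t).
    by rewrite /floor_path -/k /q /= Ns; ring.
  have -> : shear c fp q t = (q t).1 - c * fp t * wt by [].
  by rewrite fst stE -rr /cn; field; rewrite gt_eqF.
have e1 : `|(cn - c) * (fp u * ws)| <= `|cn - c| * (B * m.+1%:R).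
  by rewrite normrM ler_wpM2l// normrM ler_pM//; exact: fpB.
have e2 : `|c * ((fp u - fp t) * ws)| <= c * (v0 * m.+1%:R).
  rewrite normrM (ger0_norm c0) ler_wpM2l// normrM ler_pM//.
  by apply: fpD => //; exact: le_trans stD.
have e3 : `|c * (fp t * (ws - wt))| <= c * (B * v).
  by rewrite normrM (ger0_norm c0) ler_wpM2l// normrM ler_pM//; exact: fpB.
have cn0 : 0 <= cn by rewrite /cn divr_ge0// ?mulr_ge0// ltW.
have e4 : `|cn * (fp u * th / r)| <= cn * (B / r).
  rewrite normrM (ger0_norm cn0) ler_wpM2l// normrM normfV (gtr0_norm r0).
  rewrite ler_pM2r ?invr_gt0// normrM -[B]mulr1 ler_pM//; first exact: fpB.
  by rewrite ger0_norm.
apply: (le_trans (ler_normB _ _)).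
have e5 := le_trans (ler_normD _ _) (lerD (le_trans (ler_normD _ _) (lerD
  (le_trans (ler_normD _ _) (lerD e1 e2)) e3)) e4).
apply: (le_trans (lerD q1 e5)).
move: err; rewrite -/r -/cn mulrDl mul1r -mulrA.
move: (`|cn - c| * _) (c * (v0 * _)) (c * (B * v)) (cn * _) (m.+1%:R^-1).
by move=> *; lra.
Qed.

Lemma floor_path_cadlag (a b : R) (n : nat) x : (0 < n)%N ->
  cadlag (floor_path a b n x).
Proof.
move=> n0; have n0' : 0 < n%:R :> R by rewrite ltr0n.
have /within01_continuousP fc' := fc.
(* Among points of one level [k] the path varies only through the continuous [f]; both one-sided
   limits follow from this. *)
have key (t : R) (k : nat) : 0 <= t <= 1 -> forall e : R, 0 < e -> exists2 d : R, 0 < d &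
   forall s, 0 <= s <= 1 -> `|t - s| < d -> Num.truncn (n%:R * s) = k ->
   `|(a * (x k - b * f t) : R^o) - floor_path a b n x s| < e.
  move=> t01 e e0; pose A := `|a * b| + 1.
  have A0 : 0 < A by rewrite ltr_wpDl.
  have [d d0 H] := fc' t t01 (e / A) ltac:(by rewrite divr_gt0).
  exists d => // s s01 ts sk; rewrite /floor_path sk.
  have -> : a * (x k - b * f t) - a * (x k - b * f s) = - (a * b) * (f t - f s) by ring.
  rewrite normrM normrN; apply: (@le_lt_trans _ _ (`|a * b| * (e / A))).
    by rewrite ler_wpM2l// ltW// H.
  by rewrite mulrA ltr_pdivrMr// mulrC ltr_pM2l// /A ltrDl.
split=> t /andP[t0 t1].
  have t01 : 0 <= t <= 1 by rewrite t0 ltW.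
  pose k := Num.truncn (n%:R * t).
  have /andP[k1 k2] : k%:R <= n%:R * t < k.+1%:R.
    by apply: truncn_itv; rewrite mulr_ge0// ltW.
  apply/cvgrPdist_lt => e e0; have [d d0 H] := key t k t01 e e0.
  have kt : 0 < k.+1%:R / n%:R - t by rewrite subr_gt0 ltr_pdivlMr// mulrC.
  have m0 : 0 < Num.min d (Num.min (1 - t) (k.+1%:R / n%:R - t)).
    by rewrite !lt_min d0 subr_gt0 t1.
  exists (Num.min d (Num.min (1 - t) (k.+1%:R / n%:R - t))) => // s /=.
  rewrite !lt_min => /andP[sd /andP[s1 sk]] ts.
  move: s1 sk; rewrite distrC ger0_norm ?subr_ge0 ?(ltW ts)// => s1 sk.
  have s1' : s < 1 by move: s1; lra.
  have sk' : s < k.+1%:R / n%:R by move: sk; move: (k.+1%:R / n%:R) => z; lra.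
  apply: H => //; first by rewrite (le_trans t0 (ltW ts)) ltW.
  apply: truncn_def; apply/andP; split.
    by apply: (le_trans k1); rewrite ler_pM2l// ltW.
  by move: sk'; rewrite ltr_pdivlMr// mulrC.
have t01 : 0 <= t <= 1 by rewrite t1 ltW.
have nt0 : 0 < n%:R * t by rewrite mulr_gt0.
(* For the left limit a grid point belongs to the preceding cell, open on the left and closed on the
   right. *)
have [k [k1 k2]] : exists k : nat, k%:R < n%:R * t /\ n%:R * t <= k.+1%:R.
  have /andP[h1 h2] := truncn_itv (ltW nt0).
  move: h1; rewrite le_eqVlt => /predU1P[h|h]; last by exists (Num.truncn (n%:R * t)); split => //; exact: ltW.
  move: h h2; case: (Num.truncn _) => [|k] h h2; first by move: nt0; rewrite -h ltxx.
  by exists k; rewrite -h ltr_nat ltnS leqnn lexx.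
apply/cvg_ex; exists (a * (x k - b * f t) : R^o).
apply/cvgrPdist_lt => e e0; have [d d0 H] := key t k t01 e e0.
have kt : 0 < t - k%:R / n%:R by rewrite subr_gt0 ltr_pdivrMr// mulrC.
have m0 : 0 < Num.min d (Num.min t (t - k%:R / n%:R)) by rewrite !lt_min d0 t0.
exists (Num.min d (Num.min t (t - k%:R / n%:R))) => // s /=.
rewrite !lt_min => /andP[sd /andP[s1 sk]] ts.
move: s1 sk; rewrite ger0_norm ?subr_ge0 ?(ltW ts)// => s1 sk.
have s0 : 0 < s by move: s1; lra.
have sk' : k%:R / n%:R < s by move: sk; move: (k%:R / n%:R) => z; lra.
apply: H => //; first by rewrite (le_trans (ltW ts) t1) ltW.
apply: truncn_def; apply/andP; split.
  by move: sk'; rewrite ltr_pdivrMr// mulrC => /ltW.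
by apply: lt_le_trans k2; rewrite ltr_pM2l.
Qed.

End FloorPaths.

(** * Uniform samples *)

Section BoundedExpectation.
Context {R : realType} {d : measure_display} {Om : measurableType d}.
Variable P : probability Om R.

Lemma bounded_integrable (f : Om -> R) (M : R) : measurable_fun setT f ->
  (forall w, `|f w| <= M) -> P.-integrable setT (EFin \o f).
Proof.
move=> mf fM; apply: measurable_bounded_integrable => //.
- by rewrite -ge0_fin_numE//; exact: fin_num_measure.
- exists M; split; first exact: num_real.
  by move=> x Mx w _ /=; apply: le_trans (fM w) (ltW Mx).
Qed.

Lemma Rintegral_sum (I : Type) (s : seq I) (f : I -> Om -> R) :
  (forall i, P.-integrable setT (EFin \o f i)) ->
  \int[P]_w (\sum_(i <- s) f i w) = \sum_(i <- s) \int[P]_w f i w.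
Proof.
move=> fi; elim: s => [|i s IH].
  by rewrite big_nil; under eq_Rintegral do rewrite big_nil; rewrite Rintegral_cst// mul0r.
rewrite big_cons -IH -RintegralD//; last first.
  have -> : EFin \o (fun w => \sum_(i <- s) f i w) =
      (fun w => \sum_(i <- s) (EFin \o f i) w)%E.
    by apply/funext => w /=; rewrite sumEFin.
  exact: integrable_sum.
by apply: eq_Rintegral => w _; rewrite big_cons.
Qed.

Lemma integrableD_EFin (f g : Om -> R) : P.-integrable setT (EFin \o f) ->
  P.-integrable setT (EFin \o g) -> P.-integrable setT (EFin \o (fun w => f w + g w)).
Proof. by move=> fi gi; exact: (integrableD measurableT fi gi). Qed.

Lemma integrableB_EFin (f g : Om -> R) : P.-integrable setT (EFin \o f) ->
  P.-integrable setT (EFin \o g) -> P.-integrable setT (EFin \o (fun w => f w - g w)).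
Proof. by move=> fi gi; exact: (integrableB measurableT fi gi). Qed.

Lemma integrableZl_EFin (k : R) (f : Om -> R) : P.-integrable setT (EFin \o f) ->
  P.-integrable setT (EFin \o (fun w => k * f w)).
Proof. by move=> fi; exact: (integrableZl measurableT k fi). Qed.

Lemma Rintegral_indic (A : set Om) : measurable A -> \int[P]_w \1_A w = fine (P A).
Proof. by move=> mA; rewrite /Rintegral integral_indic// setIT. Qed.

Lemma Rintegral_prob_cst (r : R) : \int[P]_w r = r.
Proof. by rewrite Rintegral_cst// (_ : _ [set: Om] = 1%E) ?mulr1//; exact: probability_setT. Qed.

End BoundedExpectation.

Section UniformSample.
Context {R : realType} {d : measure_display} {Om : measurableType d}.
Variables (P : probability Om R) (n : nat) (T : 'I_n -> Om -> R).
Hypothesis Tunif : forall i, uniform01 P (T i).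
Hypothesis Tind : mutually_independent P T.

Let mT i (A : set R) : measurable A -> measurable (T i @^-1` A).
Proof. by move=> mA; rewrite -[_ @^-1` _]setTI; exact: (Tunif i).1. Qed.

Lemma pairwise_independent i j (A B : set R) : i != j ->
  measurable A -> measurable B ->
  P (T i @^-1` A `&` T j @^-1` B) = (P (T i @^-1` A) * P (T j @^-1` B))%E.
Proof.
move=> ij mA mB.
have -> : T i @^-1` A `&` T j @^-1` B = \bigcap_(k in [set: 'I_n])
    (T k @^-1` (if k == i then A else if k == j then B else setT)).
  apply/seteqP; split=> [w [Aw Bw] k _ /=|w H].
    by case: eqP => [->//|_]; case: eqP => [->//|_].
  split; have := H _ I; first by move=> /(_ i); rewrite /= eqxx.
  by move=> /(_ j); rewrite /= eqxx eq_sym (negbTE ij).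
rewrite Tind; last by move=> k; case: ifP => // _; case: ifP.
have ji : (j == i) = false by rewrite eq_sym (negbTE ij).
rewrite (bigD1 i)//= eqxx (bigD1 j) ?ji//= eqxx.
rewrite big1 ?mule1// => k /andP[/negbTE -> /negbTE ->].
by rewrite preimage_setT; exact: probability_setT.
Qed.

Lemma uniform01_le i t : 0 <= t <= 1 -> P (T i @^-1` `]-oo, t]) = t%:E.
Proof.
move=> /andP[t0 t1]; rewrite (Tunif i).2//.
have -> : `]-oo, t]%classic `&` `[0, 1]%classic = `[(0 : R), t]%classic.
  apply/seteqP; split => x /=; rewrite !in_itv/=; first by move=> [-> /andP[->]].
  by move=> /andP[-> xt]; rewrite xt (le_trans xt).
by rewrite lebesgue_measure_itv/= lte_fin; case: ltgtP t0 => // [_|<-] _; rewrite ?oppr0 ?adde0.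
Qed.

Lemma uniform01_ae_range i : {ae P, forall w, 0 < T i w <= 1}.
Proof.
exists (T i @^-1` (~` `]0, 1])); split.
- exact/mT/measurableC.
- rewrite (Tunif i).2; last exact: measurableC.
  have -> : ~` `](0 : R), 1]%classic `&` `[0, 1]%classic = [set 0].
    apply/seteqP; split => x /=; rewrite !in_itv/=.
      move=> [/negP h /andP[x0 x1]]; move: h; rewrite x1 andbT -leNgt => x0'.
      by apply/eqP; rewrite eq_le x0 x0'.
    by move=> ->; rewrite ltxx lexx ler01.
  exact: lebesgue_measure_set1.
- by move=> w /= h; rewrite in_itv.
Qed.

(** Independence concerns rectangles, so the diagonal is covered by [L.+1] squares, each of
    probability at most [L.+1%:R^-1] squared. Cells open on the left match the range []0, 1]]. *)
Lemma uniform01_ae_neq i j : i != j -> {ae P, forall w, 0 < T i w <= 1 -> T i w <> T j w}.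
Proof.
move=> ij; pose E := (fun w => T i w - T j w) @^-1` [set 0] `&` T i @^-1` `]0, 1].
have mE : measurable E.
  apply: measurableI; last exact: mT.
  rewrite -[X in measurable X]setTI.
  by apply: measurable_funB => //; [exact: (Tunif i).1|exact: (Tunif j).1].
exists E; split=> //; last first.
  move=> w /= /not_implyP[h1 h2]; split; last by rewrite /= in_itv.
  by apply/eqP; rewrite /= subr_eq0; apply/eqP; exact: contrapT.
(* two samples fall in the same cell of a grid of mesh 1/L with probability at most 1/L *)
have key (L : nat) : (P E <= (L.+1%:R^-1)%:E)%E.
  have L0 : 0 < L.+1%:R :> R by [].
  pose I (l : nat) : set R := `]l%:R / L.+1%:R, l.+1%:R / L.+1%:R]%classic.
  pose F (l : nat) := T i @^-1` I l `&` T j @^-1` I l.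
  have mI l : measurable (I l) by exact: measurable_itv.
  have mF l : measurable (F l) by apply: measurableI; exact: mT.
  pose J : set R := `[0, 1]%classic.
  have Il l : (lebesgue_measure (I l `&` J) <= (L.+1%:R^-1)%:E)%E.
    apply: (@le_trans _ _ (lebesgue_measure (I l))).
      by apply: measureIl => //; exact: measurable_itv.
    rewrite lebesgue_measure_itv/=; case: ifP => // _.
    by rewrite -EFinB lee_fin -mulrBl -natrB// subSnn mul1r.
  apply: (@le_trans _ _ (P (\big[setU/set0]_(l < L.+1) F l))).
    apply: le_measure; rewrite ?inE//; first exact: bigsetU_measurable.
    move=> w [/= /eqP]; rewrite subr_eq0 => /eqP TE; rewrite in_itv/= => /andP[t0 t1].
    have y0 : 0 < L.+1%:R * T i w by rewrite mulr_gt0.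
    have [k [k1 k2]] : exists k : nat, k%:R < L.+1%:R * T i w /\ L.+1%:R * T i w <= k.+1%:R.
      have /andP[h1 h2] := truncn_itv (ltW y0).
      move: h1; rewrite le_eqVlt => /predU1P[h|h].
        move: h h2; case: (Num.truncn _) => [|k] h h2; first by move: y0; rewrite -h ltxx.
        by exists k; rewrite -h ltr_nat ltnS leqnn lexx.
      by exists (Num.truncn (L.+1%:R * T i w)); split => //; exact: ltW.
    have kL : (k < L.+1)%N.
      rewrite -(ltr_nat R); apply: (lt_le_trans k1).
      by rewrite ler_piMr// ltW.
    rewrite -bigcup_mkord; exists k => //.
    have : I k (T i w).
      rewrite /I /= in_itv/= ltr_pdivrMr// ler_pdivlMr// (mulrC (T i w)).
      by apply/andP.
    by split => //; rewrite /preimage /= -TE.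
  apply: (le_trans (Boole_inequality P _)) => //.
  apply: (@le_trans _ _ (\sum_(l < L.+1) (L.+1%:R^-1 * L.+1%:R^-1)%:E)%E).
    apply: lee_sum => l _.
    have := pairwise_independent i j (I l) (I l) ij (mI l) (mI l).
    rewrite (Tunif i).2// (Tunif j).2// => PF.
    apply: (@le_trans _ _ (P (F l))) => //.
    by rewrite PF EFinM; apply: lee_pmul => //; exact: Il.
  rewrite sumEFin sumr_const card_ord lee_fin -[leLHS]mulr_natr -mulrA mulVf ?mulr1//.
apply/eqP; rewrite eq_le measure_ge0 andbT.
apply/lee_addgt0Pr => e e0; rewrite add0e.
have /filter_ex[L Le] := near_infty_natSinv_lt (PosNum e0).
by apply: (le_trans (key L)); rewrite lee_fin ltW.
Qed.

Lemma uniform_sample_ae_distinct :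
  {ae P, forall w, injective (T ^~ w) /\ forall i, 0 < T i w <= 1}.
Proof.
have h1 : {ae P, forall w, forall i, 0 < T i w <= 1}.
  by apply: filter_forall => i; exact: uniform01_ae_range.
have h2 : {ae P, forall w, forall i j, i != j -> 0 < T i w <= 1 -> T i w <> T j w}.
  apply: filter_forall => i; apply: filter_forall => j.
  have [->|ij] := eqVneq i j; first exact: aeW.
  by move: (uniform01_ae_neq i j ij); apply: filterS => w h _; exact: h.
apply: filterS2 h1 h2 => w w1 w2; split=> // i j /= Tij.
by have [//|/w2/(_ (w1 i))] := eqVneq i j.
Qed.

End UniformSample.

(** * Moments of the counting process *)

(** Compare after multiplication by [1 - x]: the left side becomes at most 1 because
    [1 - x <= expR (- x)], the right side becomes [1 + x ^+ 2 * (1 - 2 * x)]. *)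
Lemma expR_le_quadratic {R : realType} (x : R) : x <= 2^-1 ->
  expR x <= 1 + x + 2 * x ^+ 2.
Proof.
move=> x2; have y0 : 0 < 1 - x by lra.
have : (1 - x) * expR x <= 1.
  have := ler_wpM2r (expR_ge0 x) (expR_ge1Dx (- x)).
  by rewrite -expRD addNr expR0.
have : 1 <= (1 - x) * (1 + x + 2 * x ^+ 2).
  have -> : (1 - x) * (1 + x + 2 * x ^+ 2) = 1 + x ^+ 2 * (1 - 2 * x) by ring.
  by rewrite lerDl mulr_ge0 ?sqr_ge0//; lra.
by move=> h1 h2; rewrite -(ler_pM2l y0); exact: le_trans h2 h1.
Qed.

(** The fourth Taylor term of the exponential at [x / 2] gives the factor [16 = 2 ^ 4]; adding the
    two exponentials covers both signs of [x]. *)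
Lemma fourth_power_le_expR {R : realType} (x : R) :
  x ^+ 4 <= 16 * 4`!%:R * (expR (x / 2) + expR (- (x / 2))).
Proof.
have F0 : 0 < 4`!%:R :> R by rewrite ltr0n fact_gt0.
move: (@expR_ge1Dxn R) F0 => /(_ _ 3); move: (4`!%:R : R) => F expF F0.
have pos (y : R) : 0 <= y -> y ^+ 4 <= 16 * F * expR (y / 2).
  move=> y0; have h := expF (y / 2) ltac:(by rewrite divr_ge0).
  have -> : y ^+ 4 = 16 * F * ((y / 2) ^+ 4 / F) by field; rewrite gt_eqF.
  by rewrite ler_pM2l ?mulr_gt0//; move: h; clear; lra.
have F16 : 0 <= 16 * F by rewrite mulr_ge0// ltW.
rewrite mulrDr; have [x0|x0] := leP 0 x.
  by apply: (le_trans (pos x x0)); rewrite lerDl mulr_ge0// expR_ge0.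
have -> : x ^+ 4 = (- x) ^+ 4 by ring.
apply: (le_trans (pos (- x) _)); first by rewrite oppr_ge0 ltW.
by rewrite mulNr lerDr mulr_ge0// expR_ge0.
Qed.

Lemma prod_indic {R : realType} {Om : Type} n (A : 'I_n -> set Om) (w : Om) :
  \prod_(i < n) (\1_(A i) w : R) = \1_(\bigcap_(i in [set: 'I_n]) A i) w.
Proof.
rewrite indicE; case: (boolP (w \in _)) => [|].
  by rewrite inE => H; apply: big1 => i _; rewrite indicE mem_set//; exact: H.
rewrite notin_setE => H.
have [i nA] : exists i, ~ A i w.
  by apply: contrapT => h; apply: H => i _; apply: contrapT => nA; apply: h; exists i.
by rewrite (bigD1 i)//= indicE memNset// mul0r.
Qed.

Section CountingMoments.
Context {R : realType} {d : measure_display} {Om : measurableType d}.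
Variables (P : probability Om R) (n : nat) (T : 'I_n -> Om -> R).
Hypothesis Tunif : forall i, uniform01 P (T i).
Hypothesis Tind : mutually_independent P T.

Let mT i (A : set R) : measurable A -> measurable (T i @^-1` A).
Proof. by move=> mA; rewrite -[_ @^-1` _]setTI; exact: (Tunif i).1. Qed.

Let H i (t : R) : set Om := T i @^-1` `]-oo, t].

Let mH i t : measurable (H i t).
Proof. exact: mT. Qed.

Let mindicH i t : measurable_fun setT (\1_(H i t) : Om -> R).
Proof. exact: measurable_indic. Qed.

Lemma count_proc_indic t w : (count_proc T t w)%:R = \sum_(i < n) (\1_(H i t) w : R).
Proof.
rewrite /count_proc natr_sum; apply: eq_bigr => i _.
rewrite indicE; congr ((nat_of_bool _)%:R).
by apply/idP/idP; rewrite /H inE /= in_itv.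
Qed.

Lemma centered_countE t w : (count_proc T t w)%:R - n%:R * t =
  \sum_(i < n) (\1_(H i t) w - t).
Proof.
by rewrite count_proc_indic sumrB sumr_const card_ord mulr_natl.
Qed.

Lemma measurable_count_proc t : measurable_fun setT (fun w => (count_proc T t w)%:R : R).
Proof.
under eq_fun do rewrite count_proc_indic.
by apply: measurable_sum => i; exact: mindicH.
Qed.

Let indic_bound (A : set Om) w : `|\1_A w : R| <= 1.
Proof. by rewrite indicE; case: (_ \in _); rewrite ?normr1 ?normr0. Qed.

Let int_indic (A : set Om) : measurable A -> P.-integrable setT (EFin \o (\1_A : Om -> R)).
Proof.
by move=> mA; apply: (@bounded_integrable _ _ _ P _ 1) => //; exact: measurable_indic.
Qed.

Let int_cst (c : R) : P.-integrable setT (EFin \o (fun _ : Om => c)).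
Proof. exact: finite_measure_integrable_cst. Qed.

Let int_centered i t : P.-integrable setT (EFin \o (fun w => \1_(H i t) w - t)).
Proof. by apply: integrableB_EFin => //; exact: int_indic. Qed.

Lemma Rintegral_centered_count t : 0 <= t <= 1 ->
  \int[P]_w ((count_proc T t w)%:R - n%:R * t) = 0.
Proof.
move=> t01; under eq_Rintegral do rewrite centered_countE.
rewrite Rintegral_sum//; apply: big1 => i _.
rewrite RintegralB//; last exact: int_indic.
rewrite Rintegral_prob_cst Rintegral_indic// /H.
by rewrite (uniform01_le P n T Tunif)// subrr.
Qed.

Lemma Rintegral_centered_count_mul s t : 0 <= s -> s <= t -> t <= 1 ->
  \int[P]_w (((count_proc T s w)%:R - n%:R * s) * ((count_proc T t w)%:R - n%:R * t)) =
  n%:R * (s * (1 - t)).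
Proof.
move=> s0 st t1.
have s01 : 0 <= s <= 1 by rewrite s0 (le_trans st).
have t01 : 0 <= t <= 1 by rewrite t1 (le_trans s0 st).
pose g i j w : R := \1_(H i s `&` H j t) w - t * \1_(H i s) w - s * \1_(H j t) w + s * t.
have gE w : ((count_proc T s w)%:R - n%:R * s) * ((count_proc T t w)%:R - n%:R * t) =
    \sum_(i < n) \sum_(j < n) g i j w.
  rewrite !centered_countE big_distrlr /=; apply: eq_bigr => i _; apply: eq_bigr => j _.
  by rewrite /g indicI /=; ring.
have i1 i t' (c' : R) : P.-integrable setT (EFin \o (fun w => c' * \1_(H i t') w)).
  by apply: integrableZl_EFin; exact: int_indic.
have i2 i j : P.-integrable setT (EFin \o (\1_(H i s `&` H j t) : Om -> R)).
  by apply: int_indic; exact: measurableI.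
have i3 i j : P.-integrable setT (EFin \o (fun w => \1_(H i s `&` H j t) w - t * \1_(H i s) w)).
  by apply: integrableB_EFin; [exact: i2|exact: i1].
have i4 i j : P.-integrable setT (EFin \o (fun w => \1_(H i s `&` H j t) w - t * \1_(H i s) w - s * \1_(H j t) w)).
  by apply: integrableB_EFin; [exact: i3|exact: i1].
have gi i j : P.-integrable setT (EFin \o g i j).
  by apply: integrableD_EFin; [exact: i4|exact: int_cst].
have gI i j : \int[P]_w g i j w = if i == j then s * (1 - t) else 0.
  rewrite /g RintegralD// RintegralB// RintegralB// !RintegralZl//; try exact: int_indic.
  rewrite !Rintegral_indic//; last exact: measurableI.
  rewrite Rintegral_prob_cst /H !(uniform01_le P n T Tunif)//=.
  have [->|ij] := eqVneq i j.
    have -> : T j @^-1` `]-oo, s] `&` T j @^-1` `]-oo, t] = T j @^-1` `]-oo, s].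
      apply/seteqP; split => w /=; first by move=> [].
      by rewrite !in_itv/= => ws; split => //; exact: le_trans st.
    by rewrite (uniform01_le P n T Tunif)//=; ring.
  rewrite (pairwise_independent P n T Tind)// !(uniform01_le P n T Tunif)//=.
  by ring.
under eq_Rintegral do rewrite gE.
rewrite Rintegral_sum; last first.
  move=> i; have -> : EFin \o (fun w => \sum_(j < n) g i j w) =
      (fun w => \sum_(j < n) (EFin \o g i j) w)%E.
    by apply/funext => w /=; rewrite sumEFin.
  exact: integrable_sum.
rewrite (eq_bigr (fun=> s * (1 - t))); last first.
  move=> i _; rewrite Rintegral_sum// (bigD1 i)//= gI eqxx big1 ?addr0// => j.
  by rewrite gI eq_sym => /negbTE ->.
by rewrite sumr_const card_ord mulr_natl.
Qed.

(** Mutual independence is given for events. Each factor is written as a two-term combination of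
    indicators and the product is expanded over all patterns in [{ffun 'I_n -> bool}]; after
    integration the same distributivity refolds the sum into a power. *)
Lemma Rintegral_expR_count (v t : R) : 0 <= t <= 1 ->
  \int[P]_w expR (v * ((count_proc T t w)%:R - n%:R * t)) =
  (t * expR (v * (1 - t)) + (1 - t) * expR (- (v * t))) ^+ n.
Proof.
move=> t01.
pose A (b : bool) : set R := if b then `]-oo, t]%classic else ~` `]-oo, t]%classic.
pose c (b : bool) : R := if b then expR (v * (1 - t)) else expR (- (v * t)).
pose p (b : bool) : R := if b then t else 1 - t.
have mA b : measurable (A b).
  by case: b; [exact: measurable_itv|apply: measurableC; exact: measurable_itv].
have PA i b : P (T i @^-1` A b) = (p b)%:E.
  case: b; first exact: uniform01_le.
  have := @probability_setC _ _ _ P (H i t) (mH i t).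
  by rewrite /A preimage_setC /H (uniform01_le P n T Tunif).
have cE i w : expR (v * (\1_(H i t) w - t)) = \sum_(b : bool) c b * \1_(T i @^-1` A b) w.
  rewrite big_bool /= /c /A /H !indicE preimage_setC in_setC.
  case: (_ \in _); rewrite /= ?mulr1 ?mulr0 ?addr0 ?add0r//.
  by congr expR; ring.
pose C (phi : {ffun 'I_n -> bool}) := \prod_(i < n) c (phi i).
pose B (phi : {ffun 'I_n -> bool}) := \bigcap_(i in [set: 'I_n]) (T i @^-1` A (phi i)).
have mB phi : measurable (B phi).
  by apply: fin_bigcap_measurable => // i _; exact: mT.
have eE w : expR (v * ((count_proc T t w)%:R - n%:R * t)) =
    \sum_(phi : {ffun 'I_n -> bool}) C phi * \1_(B phi) w.
  rewrite centered_countE mulr_sumr expR_sum.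
  under eq_bigr do rewrite cE.
  rewrite bigA_distr_bigA /=; apply: eq_bigr => phi _.
  by rewrite big_split/= -/(C phi) prod_indic.
under eq_Rintegral do rewrite eE.
rewrite Rintegral_sum; last first.
  move=> phi; apply: (@bounded_integrable _ _ _ P _ `|C phi|).
    by apply: measurable_funM => //; exact: measurable_indic.
  by move=> w; rewrite normrM ler_piMr.
under eq_bigr => phi _.
  rewrite RintegralZl//; last exact: int_indic.
  rewrite Rintegral_indic// /B Tind; last by [].
  under eq_bigr do rewrite PA.
  rewrite prodEFin /= /C -big_split /=.
  over.
rewrite -(bigA_distr_bigA (fun i b => c b * p b)) /=.
under eq_bigr do rewrite big_bool /=.
by rewrite prodr_const card_ord /c /p; congr (_ ^+ _); ring.
Qed.

End CountingMoments.

Section NormalizedMoments.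
Context {R : realType} {d : measure_display} {Om : measurableType d}.
Variables (P : probability Om R) (n : nat) (T : 'I_n -> Om -> R).
Hypothesis Tunif : forall i, uniform01 P (T i).
Hypothesis Tind : mutually_independent P T.
Hypothesis n0 : (0 < n)%N.

Definition normalized_count (t : R) (w : Om) : R :=
  ((count_proc T t w)%:R - n%:R * t) / Num.sqrt n%:R.

Let n0' : 0 < n%:R :> R. Proof. by rewrite ltr0n. Qed.

Let r : R := Num.sqrt n%:R.

Let r0 : 0 < r. Proof. by rewrite sqrtr_gt0. Qed.

Let rr : r * r = n%:R. Proof. by rewrite -expr2 sqr_sqrtr// ltW. Qed.

Lemma measurable_normalized_count t : measurable_fun setT (normalized_count t).
Proof.
apply: measurable_funM; last exact: measurable_cst.
apply: measurable_funB; last exact: measurable_cst.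
exact: measurable_count_proc.
Qed.

Lemma normalized_count_bounded t : 0 <= t <= 1 -> forall w, `|normalized_count t w| <= r.
Proof.
move=> /andP[t0 t1] w; rewrite /normalized_count normrM normfV (gtr0_norm r0).
rewrite ler_pdivrMr// rr.
have h1 : (count_proc T t w)%:R <= n%:R :> R by rewrite ler_nat; exact: count_proc_le.
have h2 : n%:R * t <= n%:R by rewrite ler_piMr// ltW.
have h3 : 0 <= n%:R * t by rewrite mulr_ge0// ltW.
have h4 : 0 <= (count_proc T t w)%:R :> R by [].
rewrite ler_norml; apply/andP; split; lra.
Qed.

Lemma Rintegral_normalized_count t : 0 <= t <= 1 ->
  \int[P]_w normalized_count t w = 0.
Proof.
move=> t01; rewrite /normalized_count RintegralZr//.
  by rewrite (Rintegral_centered_count P n T Tunif)// mul0r.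
apply: (@bounded_integrable _ _ _ P _ (r * r)).
  by apply: measurable_funB; [exact: measurable_count_proc|exact: measurable_cst].
move=> w; have := normalized_count_bounded t t01 w.
by rewrite /normalized_count normrM normfV (gtr0_norm r0) ler_pdivrMr.
Qed.

Lemma Rintegral_normalized_count_mul s t : 0 <= s -> s <= t -> t <= 1 ->
  \int[P]_w (normalized_count s w * normalized_count t w) = s * (1 - t).
Proof.
move=> s0 st t1.
have E w : normalized_count s w * normalized_count t w = n%:R^-1 *
  (((count_proc T s w)%:R - n%:R * s) * ((count_proc T t w)%:R - n%:R * t)).
  by rewrite /normalized_count -/r -rr; field; rewrite gt_eqF.
under eq_Rintegral do rewrite E.
have s01 : 0 <= s <= 1 by rewrite s0 (le_trans st).
have t01 : 0 <= t <= 1 by rewrite t1 (le_trans s0 st).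
rewrite RintegralZl//.
  rewrite (Rintegral_centered_count_mul P n T Tunif Tind)//.
  by rewrite mulKf// gt_eqF.
apply: (@bounded_integrable _ _ _ P _ (n%:R * (r * r))).
  by apply: measurable_funM; apply: measurable_funB; do ?[exact: measurable_count_proc|exact: measurable_cst].
move=> w; have h1 := normalized_count_bounded s s01 w.
have h2 := normalized_count_bounded t t01 w.
have : `|normalized_count s w * normalized_count t w| <= r * r by rewrite normrM ler_pM.
by rewrite E normrM normfV (gtr0_norm n0') -ler_pdivlMl ?invr_gt0// invrK.
Qed.

(** Exponential moments avoid a fourfold expansion. The linear terms of a centered Bernoulli factor
    cancel, so the factor is at most [expR (2 * u ^+ 2)]; at [u = (2 * r)^-1] or its opposite the
    [n]-th power is [expR 2^-1], below [expR 1]. The leading 2 counts the two exponentials. *)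
Lemma Rintegral_normalized_count4 t : 0 <= t <= 1 ->
  \int[P]_w (normalized_count t w ^+ 4) <= 2 * (16 * 4`!%:R) * expR 1.
Proof.
move=> t01; have /andP[t0 t1] := t01.
have mN := measurable_normalized_count t.
have F40 : 0 < 16 * 4`!%:R :> R by rewrite mulr_gt0// ltr0n fact_gt0.
have := @fourth_power_le_expR R; move: F40; move: (16 * 4`!%:R : R) => F4 F40 x4.
have bound (u : R) : `|u| = (2 * r)^-1 ->
    \int[P]_w expR (u * ((count_proc T t w)%:R - n%:R * t)) <= expR 1.
  move=> uE; rewrite (Rintegral_expR_count P n T Tunif Tind)//.
  have u2 : `|u| <= 2^-1.
    rewrite uE lef_pV2 ?posrE ?mulr_gt0// ler_peMr//.
    by rewrite -[1]sqrtr1 ler_wsqrtr// ler1n.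
  have /andP[u3 u4] : - 2^-1 <= u <= 2^-1 by rewrite -ler_norml.
  have a1 : u * (1 - t) <= 2^-1.
    have := ler_wpM2r (_ : 0 <= 1 - t) u4; move=> h; apply: (le_trans (h _)); lra.
  have a2 : - (u * t) <= 2^-1.
    have : - u <= 2^-1 by lra.
    move=> /(ler_wpM2r t0) h; rewrite -mulNr; apply: (le_trans h); lra.
  have b1 := ler_wpM2l t0 (expR_le_quadratic _ a1).
  have b2 := ler_wpM2l (_ : 0 <= 1 - t) (expR_le_quadratic _ a2).
  have {}b2 := b2 ltac:(lra).
  have le1 : t * expR (u * (1 - t)) + (1 - t) * expR (- (u * t)) <= expR (2 * u ^+ 2).
    apply: (le_trans (lerD b1 b2)); apply: le_trans (expR_ge1Dx _).
    have -> : t * (1 + u * (1 - t) + 2 * (u * (1 - t)) ^+ 2) +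
      (1 - t) * (1 + - (u * t) + 2 * (- (u * t)) ^+ 2) =
      1 + 2 * u ^+ 2 * (t * (1 - t)) by ring.
    have q1 : t * (1 - t) <= 1 by apply: mulr_ile1; lra.
    have q2 : 0 <= 2 * u ^+ 2 by rewrite mulr_ge0// sqr_ge0.
    by rewrite lerD2l ler_piMr.
  apply: (@le_trans _ _ (expR (2 * u ^+ 2) ^+ n)).
    apply: lerXn2r; rewrite ?nnegrE ?expR_ge0//.
    by rewrite addr_ge0// mulr_ge0 ?expR_ge0//; lra.
  rewrite -expRM_natl ler_expR -real_normK ?num_real// uE exprVn exprMn.
  rewrite (_ : r ^+ 2 = n%:R); last by rewrite expr2.
  have -> : n%:R * (2 * (2 ^+ 2 * n%:R)^-1) = 2^-1 :> R.
    by field; rewrite gt_eqF.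
  lra.
have hexp (u : R) : P.-integrable setT (EFin \o (fun w => expR (u * normalized_count t w))).
  apply: (@bounded_integrable _ _ _ P _ (expR (`|u| * r))).
    by apply: measurableT_comp => //; apply: measurable_funM => //; exact: measurable_cst.
  move=> w; rewrite ger0_norm ?expR_ge0// ler_expR.
  apply: (le_trans (ler_norm _)); rewrite normrM ler_wpM2l//.
  exact: normalized_count_bounded.
have h1 := hexp (2^-1); have h2 := hexp (- 2^-1).
have e1 : \int[P]_w expR (2^-1 * normalized_count t w) <= expR 1.
  have := bound (2 * r)^-1 ltac:(by rewrite ger0_norm// invr_ge0 mulr_ge0// ltW).
  congr (_ <= _); apply: eq_Rintegral => w _; congr expR.
  by rewrite /normalized_count -/r; field; rewrite gt_eqF.
have e2 : \int[P]_w expR (- 2^-1 * normalized_count t w) <= expR 1.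
  have := bound (- (2 * r)^-1) ltac:(by rewrite normrN ger0_norm// invr_ge0 mulr_ge0// ltW).
  congr (_ <= _); apply: eq_Rintegral => w _; congr expR.
  by rewrite /normalized_count -/r; field; rewrite gt_eqF.
have h3 : P.-integrable setT (EFin \o (fun w => expR (2^-1 * normalized_count t w) +
    expR (- 2^-1 * normalized_count t w))) by exact: integrableD_EFin.
apply: (@le_trans _ _ (\int[P]_w (F4 * (expR (2^-1 * normalized_count t w) +
    expR (- 2^-1 * normalized_count t w))))).
  apply: le_Rintegral => //.
  - apply: (@bounded_integrable _ _ _ P _ (r ^+ 4)).
      exact: measurable_funX.
    by move=> w; rewrite normrX lerXn2r ?nnegrE ?(ltW r0)//; exact: normalized_count_bounded.
  - exact: integrableZl_EFin.
  - move=> w _; apply: (le_trans (x4 _)).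
    by rewrite mulrC (mulrC _ 2^-1) mulNr mulrC.
rewrite RintegralZl// RintegralD//.
have -> : 2 * F4 * expR 1 = F4 * (expR 1 + expR 1) by ring.
by rewrite ler_pM2l// lerD.
Qed.

End NormalizedMoments.

(** * Square integrability of Gaussian variables *)

Section Density.
Context {R : realType} {d : measure_display} {S : measurableType d}.
Import HBNNSimple.

(** It suffices to test simple functions below [g]. The bound is applied to the normal density and,
    with density [\1_B], to the restriction of a probability to an event. *)
Lemma ge0_integral_density_le (mu nu : {measure set S -> \bar R}) (rho g : S -> R) :
  measurable_fun setT rho -> (forall x, 0 <= rho x) ->
  (forall A, measurable A -> nu A = (\int[mu]_(x in A) (rho x)%:E)%E) ->
  measurable_fun setT g -> (forall x, 0 <= g x) ->
  (\int[nu]_x (g x)%:E <= \int[mu]_x (g x * rho x)%:E)%E.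
Proof.
move=> mrho rho0 nuE mg g0; rewrite ge0_integralTE; last by move=> x; rewrite lee_fin.
apply: ge_ereal_sup => _ [h /= hg <-].
rewrite sintegralE fsbig_finite//=.
have hE x : h x = \sum_(y <- finmap.enum_fset (fset_set (range h))) y * \1_(h @^-1` [set y]) x.
  by rewrite fimfunE fsbig_finite.
set s := finmap.enum_fset _ in hE *.
have s0 y : y \in s -> 0 <= y.
  by move=> ys; have := ys; rewrite /s in_fset_set// inE => -[x _ <-].
(* [Num.max y 0] makes each summand nonnegative for every real [y]; on the values of [h] it equals
   [y]. *)
apply: (@le_trans _ _ (\int[mu]_x (\sum_(y <- s) (Num.max y 0 * \1_(h @^-1` [set y]) x * rho x)%:E))%E).
  rewrite ge0_integral_sum//; last 2 first.
  - move=> y; apply/measurable_EFinP; apply: measurable_funM => //.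
    by apply: measurable_funM => //; exact: measurable_indic.
  - by move=> y x _; rewrite lee_fin !mulr_ge0// le_max lexx orbT.
  rewrite big_seq [leRHS]big_seq; apply: lee_sum => y ys.
  rewrite nuE// (max_idPl _) ?s0//.
  have -> : (\int[mu]_x (y * \1_(h @^-1` [set y]) x * rho x)%:E =
     y%:E * \int[mu]_x (\1_(h @^-1` [set y]) x * rho x)%:E)%E.
    rewrite -ge0_integralZl//.
    - by apply: eq_integral => x _; rewrite -EFinM mulrA.
    - apply/measurable_EFinP; apply: measurable_funM => //; exact: measurable_indic.
    - by move=> x _; rewrite lee_fin mulr_ge0.
    - by rewrite lee_fin s0.
  rewrite integral_mkcond; apply: lee_wpmul2l; first by rewrite lee_fin s0.
  rewrite le_eqVlt; apply/orP; left; apply/eqP; apply: eq_integral => x _.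
  by rewrite /patch indicE; case: ifP => _; rewrite ?mul1r ?mul0r.
apply: ge0_le_integral => //.
- move=> x _; rewrite sumEFin lee_fin; apply: sumr_ge0 => y _.
  by rewrite !mulr_ge0// le_max lexx orbT.
- apply: emeasurable_sum => y; apply/measurable_EFinP; apply: measurable_funM => //.
  by apply: measurable_funM => //; exact: measurable_indic.
- by apply/measurable_EFinP; exact: measurable_funM.
- move=> x _; rewrite sumEFin lee_fin -mulr_suml; apply: ler_wpM2r => //.
  have := hg x; rewrite lee_fin; apply: le_trans.
  rewrite hE le_eqVlt; apply/orP; left; apply/eqP.
  by apply: eq_big_seq => y ys; rewrite (max_idPl _) ?s0.
Qed.

End Density.

Section GaussianSquare.
Context {R : realType}.

(** Doubling the standard deviation leaves a spare factor [expR (- (3 * y / 8))], with [y] the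
    squared standardized variable. It absorbs [x ^+ 2 <= 2 * s ^+ 2 * y + 2 * m ^+ 2], because
    [y * expR (- (3 * y / 8)) <= 3]; hence the coefficient 6. *)
Lemma sq_mul_normal_pdf_le (m s x : R) : 0 < s -> x ^+ 2 * normal_pdf m s x <=
  (6 * s ^+ 2 + 2 * m ^+ 2) * (normal_peak s / normal_peak (2 * s)) *
  normal_pdf m (2 * s) x.
Proof.
move=> s0; have sn0 : s != 0 by rewrite gt_eqF.
have s20 : 2 * s != 0 by rewrite mulf_neq0.
rewrite !normal_pdfE// /normal_fun.
have p0 : 0 < normal_peak s by exact: normal_peak_gt0.
have p20 : 0 < normal_peak (2 * s) by exact: normal_peak_gt0.
pose y := (x - m) ^+ 2 / s ^+ 2.
have y0 : 0 <= y by rewrite divr_ge0// sqr_ge0.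
have e1 : - (x - m) ^+ 2 / (s ^+ 2 *+ 2) = - (y / 8) - 3 * y / 8.
  by rewrite /y -mulr_natr; field.
have e2 : - (x - m) ^+ 2 / ((2 * s) ^+ 2 *+ 2) = - (y / 8).
  by rewrite /y -mulr_natr; field.
have h3 : x ^+ 2 <= 2 * s ^+ 2 * y + 2 * m ^+ 2.
  have -> : 2 * s ^+ 2 * y + 2 * m ^+ 2 = x ^+ 2 + (x - 2 * m) ^+ 2.
    by rewrite /y; field.
  by rewrite lerDl sqr_ge0.
rewrite e1 e2 expRD; clearbody y; set E := expR (- (y / 8)).
have E0 : 0 <= E by exact: expR_ge0.
have h1 : y * expR (- (3 * y / 8)) <= 3.
  have : 3 * y / 8 <= expR (3 * y / 8) by have := expR_ge1Dx (3 * y / 8); lra.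
  move=> /(ler_wpM2r (expR_ge0 (- (3 * y / 8)))).
  rewrite -expRD subrr expR0; set E' := expR _.
  have -> : y * E' = 8 / 3 * (3 * y / 8 * E') by field.
  by move: (3 * y / 8 * E') => z; lra.
have h2 : expR (- (3 * y / 8)) <= 1.
  by rewrite -[leRHS]expR0 ler_expR; lra.
have e0 := expR_ge0 (- (3 * y / 8)).
have h4 : x ^+ 2 * expR (- (3 * y / 8)) <= 6 * s ^+ 2 + 2 * m ^+ 2.
  apply: (le_trans (ler_wpM2r e0 h3)); rewrite mulrDl; apply: lerD.
    have s2 : 0 <= 2 * s ^+ 2 by rewrite mulr_ge0// sqr_ge0.
    have -> : 6 * s ^+ 2 = 2 * s ^+ 2 * 3 by ring.
    have -> : 2 * s ^+ 2 * y * expR (- (3 * y / 8)) = 2 * s ^+ 2 * (y * expR (- (3 * y / 8))) by ring.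
    exact: ler_wpM2l.
  by rewrite ler_piMr// mulr_ge0// sqr_ge0.
have -> : x ^+ 2 * (normal_peak s * (E * expR (- (3 * y / 8)))) =
  normal_peak s * E * (x ^+ 2 * expR (- (3 * y / 8))) by ring.
have -> : (6 * s ^+ 2 + 2 * m ^+ 2) * (normal_peak s / normal_peak (2 * s)) *
  (normal_peak (2 * s) * E) = normal_peak s * E * (6 * s ^+ 2 + 2 * m ^+ 2).
  by field; rewrite gt_eqF.
by rewrite ler_wpM2l// mulr_ge0// ltW.
Qed.

Lemma integral_sq_normal_prob_lty (m s : R) : 0 < s ->
  (\int[normal_prob m s]_x (x ^+ 2)%:E < +oo)%E.
Proof.
move=> s0.
have mpdf (s' : R) : measurable_fun setT (normal_pdf m s') by exact: measurable_normal_pdf.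
have msq : measurable_fun setT (fun x : R => x ^+ 2) by exact: exprn_measurable.
apply: (@le_lt_trans _ _ (\int[lebesgue_measure]_x (x ^+ 2 * normal_pdf m s x)%:E)%E).
  apply: (@ge0_integral_density_le _ _ _ lebesgue_measure (normal_prob m s)
    (normal_pdf m s) (fun x => x ^+ 2)).
  - exact: mpdf.
  - by move=> x; exact: normal_pdf_ge0.
  - by [].
  - exact: msq.
  - by move=> x; exact: sqr_ge0.
set C := (6 * s ^+ 2 + 2 * m ^+ 2) * (normal_peak s / normal_peak (2 * s)).
have C0 : 0 <= C.
  apply: mulr_ge0; first by rewrite addr_ge0// mulr_ge0// sqr_ge0.
  by rewrite divr_ge0// normal_peak_ge0.
apply: (@le_lt_trans _ _ (\int[lebesgue_measure]_x (C%:E * (normal_pdf m (2 * s) x)%:E))%E).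
  apply: ge0_le_integral => //.
  - by move=> x _; rewrite lee_fin mulr_ge0 ?sqr_ge0// normal_pdf_ge0.
  - by apply/measurable_EFinP; apply: measurable_funM; [exact: msq|exact: mpdf].
  - by apply: measurable_funeM; apply/measurable_EFinP; exact: mpdf.
  - by move=> x _; rewrite -EFinM lee_fin; exact: sq_mul_normal_pdf_le.
rewrite ge0_integralZl//.
- by rewrite integral_normal_pdf mule1 ltry.
- by apply/measurable_EFinP; exact: mpdf.
- by move=> x _; rewrite lee_fin normal_pdf_ge0.
Qed.

Lemma gaussian_rv_sq_integrable d (Om : measurableType d) (P : probability Om R)
  (Y : Om -> R) : measurable_fun setT Y -> gaussian_rv P Y ->
  P.-integrable setT (EFin \o (fun w => Y w ^+ 2)).
Proof.
move=> mY [m [s gY]].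
have msq : measurable_fun setT (fun x : R => x ^+ 2) by exact: exprn_measurable.
have sq0 x : (0 <= (x ^+ 2)%:E :> \bar R)%E by rewrite lee_fin sqr_ge0.
apply/integrableP; split; first by apply/measurable_EFinP; exact: measurable_funX.
pose X : {RV P >-> measurableTypeR R} := @mfun_Sub _ _ Om (measurableTypeR R) Y (mem_set mY).
have -> : (\int[P]_w `|(EFin \o (fun w => (Y w ^+ 2)%R)) w| =
    \int[distribution P X]_x (x ^+ 2)%:E)%E.
  rewrite ge0_integral_distribution//; last exact/measurable_EFinP.
  by apply: eq_integral => w _; rewrite /= ger0_norm ?sqr_ge0.
case: gY => -[s0 PY].
  rewrite (eq_measure_integral (\d_(m : measurableTypeR R))); last by move=> A mA _; exact: PY.
  rewrite integral_dirac//; last exact/measurable_EFinP.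
  by rewrite diracT mul1e ltry.
apply: le_lt_trans (integral_sq_normal_prob_lty m s s0).
rewrite le_eqVlt; apply/orP; left; apply/eqP.
by apply: eq_measure_integral => A mA _; exact: PY.
Qed.

End GaussianSquare.

(** * Truncated moments and discrete independence *)

Lemma normr_mul_le_sq {R : realType} (x y : R) : `|x * y| <= (x ^+ 2 + y ^+ 2) / 2.
Proof.
have h1 : 0 <= x ^+ 2 + y ^+ 2 - 2 * (x * y).
  have -> : x ^+ 2 + y ^+ 2 - 2 * (x * y) = (x - y) ^+ 2 by ring.
  exact: sqr_ge0.
have h2 : 0 <= x ^+ 2 + y ^+ 2 + 2 * (x * y).
  have -> : x ^+ 2 + y ^+ 2 + 2 * (x * y) = (x + y) ^+ 2 by ring.
  exact: sqr_ge0.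
by rewrite ler_norml; move: h1 h2; move: (x * y) => z h1 h2; apply/andP; split; lra.
Qed.

Section Truncation.
Context {R : realType}.

Definition trunc_at (k x : R) : R := Num.max (- k) (Num.min x k).

Lemma trunc_at_le k x : 0 <= k -> `|trunc_at k x| <= k.
Proof.
move=> k0; rewrite /trunc_at ler_norml.
by case: (leP x k); case: (leP (- k) x); case: (leP (- k) k); lra.
Qed.

Lemma trunc_at_id k x : `|x| <= k -> trunc_at k x = x.
Proof.
rewrite ler_norml /trunc_at => /andP[h1 h2].
by rewrite (min_idPl h2) (max_idPr h1).
Qed.

Lemma trunc_at_norm_le k x : 0 <= k -> `|trunc_at k x| <= `|x|.
Proof.
move=> k0; have [h|h] := leP `|x| k; first by rewrite trunc_at_id.
by apply: le_trans (ltW h); exact: trunc_at_le.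
Qed.

Lemma trunc_at_lip k x y : `|trunc_at k x - trunc_at k y| <= `|x - y|.
Proof.
have maxl (a b c : R) : `|Num.max a b - Num.max a c| <= `|b - c|.
  rewrite ler_norml; have := ler_norm (b - c); have := ler_norm (- (b - c)); rewrite normrN.
  by case: (leP a b); case: (leP a c); case: (leP 0 (b - c)) => *; apply/andP; split; lra.
have minl (a b c : R) : `|Num.min b a - Num.min c a| <= `|b - c|.
  rewrite ler_norml; have := ler_norm (b - c); have := ler_norm (- (b - c)); rewrite normrN.
  by case: (leP b a); case: (leP c a); case: (leP 0 (b - c)) => *; apply/andP; split; lra.
exact: le_trans (maxl _ _ _) (minl _ _ _).
Qed.

(** The error vanishes unless [|x|] or [|y|] exceeds [k]. In that case it is at most
    [x ^+ 2 + y ^+ 2], and one of the two squares is at least [k ^+ 2], which buys the factor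
    [k ^- 2] at the price of fourth powers. *)
Lemma trunc_at_mul_error k x y : 0 < k ->
  `|x * y - trunc_at k x * trunc_at k y| <= k ^- 2 * (2 * (x ^+ 4 + y ^+ 4)).
Proof.
move=> k0; have k20 : 0 < k ^+ 2 by rewrite exprn_gt0.
have e4 (z : R) : z ^+ 4 = z ^+ 2 * z ^+ 2 by ring.
have p0 : 0 <= 2 * (x ^+ 4 + y ^+ 4).
  by rewrite !e4 -!expr2 mulr_ge0// addr_ge0// sqr_ge0.
have sq (z : R) : k < `|z| -> k ^+ 2 <= z ^+ 2.
  move=> kz; rewrite -(@real_normK _ z) ?num_real//.
  by rewrite lerXn2r ?nnegrE ?(ltW k0) ?(ltW kz).
have main : `|x * y - trunc_at k x * trunc_at k y| <= x ^+ 2 + y ^+ 2.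
  apply: (le_trans (ler_normB _ _)).
  have h1 := normr_mul_le_sq x y.
  have h2 : `|trunc_at k x * trunc_at k y| <= `|x * y|.
    by rewrite !normrM ler_pM// trunc_at_norm_le// ltW.
  by move: h1 h2; lra.
suff big : k ^+ 2 <= x ^+ 2 \/ k ^+ 2 <= y ^+ 2 ->
    k ^+ 2 * (x ^+ 2 + y ^+ 2) <= 2 * (x ^+ 4 + y ^+ 4).
  have [hx|/sq hx] := leP `|x| k; last first.
    by apply: (le_trans main); rewrite ler_pdivlMl//; apply: big; left.
  have [hy|/sq hy] := leP `|y| k; last first.
    by apply: (le_trans main); rewrite ler_pdivlMl//; apply: big; right.
  by rewrite !trunc_at_id// subrr normr0 mulr_ge0// invr_ge0 ltW.
rewrite !e4; move: (sqr_ge0 x) (sqr_ge0 y); move: (x ^+ 2) (y ^+ 2) (k ^+ 2) => X Y K X0 Y0.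
have XY : X * Y <= (X * X + Y * Y) / 2.
  by have := normr_mul_le_sq X Y; rewrite !expr2; apply: le_trans; exact: ler_norm.
have X2 := mulr_ge0 X0 X0; have Y2 := mulr_ge0 Y0 Y0.
move=> [h|h]; apply: (le_trans (ler_wpM2r (addr_ge0 X0 Y0) h)); rewrite mulrDr.
  by move: XY X2 Y2; move: (X * X) (Y * Y) (X * Y) => u v w; lra.
by rewrite (mulrC Y X); move: XY X2 Y2; move: (X * X) (Y * Y) (X * Y) => u v w; lra.
Qed.

Lemma measurable_trunc_at d (Om : measurableType d) k (f : Om -> R) :
  measurable_fun setT f -> measurable_fun setT (fun w => trunc_at k (f w)).
Proof.
move=> mf; apply: measurable_maxr; first exact: measurable_cst.
by apply: measurable_minr => //; exact: measurable_cst.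
Qed.

End Truncation.

Section TruncationLimits.
Context {R : realType} {d : measure_display} {Om : measurableType d}.
Variable P : probability Om R.

Lemma sq_integrable_mul (u v : Om -> R) :
  measurable_fun setT u -> measurable_fun setT v ->
  P.-integrable setT (EFin \o (fun w => u w ^+ 2)) ->
  P.-integrable setT (EFin \o (fun w => v w ^+ 2)) ->
  P.-integrable setT (EFin \o (fun w => u w * v w)).
Proof.
move=> mu mv iu iv; apply: le_integrable (integrableD_EFin P _ _ iu iv) => //.
- by apply/measurable_EFinP; exact: measurable_funM.
- move=> w _; rewrite /= lee_fin [leRHS]ger0_norm ?addr_ge0 ?sqr_ge0//.
  have := normr_mul_le_sq (u w) (v w); have := sqr_ge0 (u w); have := sqr_ge0 (v w).
  by move: (u w ^+ 2) (v w ^+ 2) => a b; lra.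
Qed.

Lemma sq_integrable (u : Om -> R) : measurable_fun setT u ->
  P.-integrable setT (EFin \o (fun w => u w ^+ 2)) ->
  P.-integrable setT (EFin \o u).
Proof.
move=> mu iu.
have := sq_integrable_mul u (cst 1) mu (measurable_cst _) iu.
have -> : (fun w => u w * cst 1 w) = u by apply/funext => w; rewrite /= mulr1.
apply; rewrite (_ : (fun w => cst 1 w ^+ 2) = cst (1 : R)).
  exact: finite_measure_integrable_cst.
by apply/funext => w /=; rewrite expr1n.
Qed.

Lemma Rintegral_trunc_mul_cvg (u v : Om -> R) :
  measurable_fun setT u -> measurable_fun setT v ->
  P.-integrable setT (EFin \o (fun w => u w ^+ 2)) ->
  P.-integrable setT (EFin \o (fun w => v w ^+ 2)) ->
  (fun k : nat => \int[P]_w (trunc_at k.+1%:R (u w) * trunc_at k.+1%:R (v w))) @ \oo -->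
  \int[P]_w (u w * v w).
Proof.
move=> mu mv iu iv.
have iuv := sq_integrable_mul _ _ mu mv iu iv.
have := @dominated_convergence _ _ _ P setT measurableT
  (fun k w => (trunc_at k.+1%:R (u w) * trunc_at k.+1%:R (v w))%:E)
  (fun w => (u w * v w)%:E) (fun w => `|(u w * v w)%:E|)%E.
move=> [].
- move=> k; apply/measurable_EFinP.
  by apply: measurable_funM; exact: measurable_trunc_at.
- by apply/measurable_EFinP; exact: measurable_funM.
- apply/aeW => w _; apply: cvg_near_cst.
  have : \forall k \near \oo, Num.max `|u w| `|v w| < k%:R by exact: nbhs_infty_gtr.
  apply: filterS => k; rewrite gt_max => /andP[h1 h2].
  have kk : k%:R <= k.+1%:R :> R by rewrite ler_nat.
  by rewrite !trunc_at_id// (le_trans (ltW _) kk).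
- exact: integrable_abse.
- apply/aeW => w k _; rewrite /= lee_fin !normrM.
  by rewrite ler_pM// trunc_at_norm_le.
move=> _ _ cv; apply: fine_cvg.
by rewrite /Rintegral fineK//; exact: integrable_fin_num.
Qed.

End TruncationLimits.

Section MomentIdentification.
Context {R : realType} (dn : nat -> measure_display)
  (Om : forall n, measurableType (dn n)) (P : forall n, probability (Om n) R)
  (d0 : measure_display) (Om0 : measurableType d0) (P0 : probability Om0 R).
Variables (u v : forall n, Om n -> R) (u0 v0 : Om0 -> R) (L K : R).
Hypothesis um : forall n, (0 < n)%N -> measurable_fun setT (u n).
Hypothesis vm : forall n, (0 < n)%N -> measurable_fun setT (v n).
Hypothesis ub : forall n, (0 < n)%N -> exists M, forall w, `|u n w| <= M.
Hypothesis vb : forall n, (0 < n)%N -> exists M, forall w, `|v n w| <= M.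
Hypothesis u4 : forall n, (0 < n)%N -> \int[P n]_w (u n w ^+ 4) <= K.
Hypothesis v4 : forall n, (0 < n)%N -> \int[P n]_w (v n w ^+ 4) <= K.
Hypothesis uvL : forall n, (0 < n)%N -> \int[P n]_w (u n w * v n w) = L.
Hypothesis u0m : measurable_fun setT u0.
Hypothesis v0m : measurable_fun setT v0.
Hypothesis u02 : P0.-integrable setT (EFin \o (fun w => u0 w ^+ 2)).
Hypothesis v02 : P0.-integrable setT (EFin \o (fun w => v0 w ^+ 2)).
Hypothesis uv_cvg : forall k : nat,
  (fun n => \int[P n]_w (trunc_at k.+1%:R (u n w) * trunc_at k.+1%:R (v n w))) @ \oo -->
  \int[P0]_w (trunc_at k.+1%:R (u0 w) * trunc_at k.+1%:R (v0 w)).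

(* bounded fourth moments make the second moments uniformly integrable *)
Lemma second_moment_limit : \int[P0]_w (u0 w * v0 w) = L.
Proof.
(* The bound is uniform in [n], so [n] can go to infinity at a fixed truncation level; [4 * K] is
   [2 * (K + K)]. *)
have err (k n : nat) : (0 < n)%N ->
  `|L - \int[P n]_w (trunc_at k.+1%:R (u n w) * trunc_at k.+1%:R (v n w))| <=
  4 * K / k.+1%:R ^+ 2.
  move=> n0; have [Mu uM] := ub n n0; have [Mv vM] := vb n n0.
  have mu := um n n0; have mv := vm n n0.
  have k0 : 0 < k.+1%:R :> R by [].
  have i1 : (P n).-integrable setT (EFin \o (fun w => u n w * v n w)).
    apply: (@bounded_integrable _ _ _ (P n) _ (Mu * Mv)); first exact: measurable_funM.
    by move=> w; rewrite normrM ler_pM.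
  have i2 : (P n).-integrable setT (EFin \o (fun w =>
      trunc_at k.+1%:R (u n w) * trunc_at k.+1%:R (v n w))).
    apply: (@bounded_integrable _ _ _ (P n) _ (k.+1%:R * k.+1%:R)).
      by apply: measurable_funM; exact: measurable_trunc_at.
    by move=> w; rewrite normrM ler_pM// trunc_at_le.
  have i4 (z : Om n -> R) M : measurable_fun setT z -> (forall w, `|z w| <= M) ->
      (P n).-integrable setT (EFin \o (fun w => z w ^+ 4)).
    move=> mz zM; apply: (@bounded_integrable _ _ _ (P n) _ (M ^+ 4)).
      exact: measurable_funX.
    move=> w; rewrite normrX lerXn2r ?nnegrE//.
    exact: le_trans (normr_ge0 _) (zM w).
  have i5 := integrableD_EFin _ _ _ (i4 _ _ mu uM) (i4 _ _ mv vM).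
  have i6 := integrableZl_EFin _ 2 _ i5.
  rewrite -(uvL n n0) -RintegralB//.
  have i7 := integrableB_EFin _ _ _ i1 i2.
  apply: (le_trans (le_normr_Rintegral _ i7)) => //.
  apply: (@le_trans _ _ (\int[P n]_w (k.+1%:R ^- 2 * (2 * (u n w ^+ 4 + v n w ^+ 4))))).
    apply: le_Rintegral => //.
    - exact: integrable_abse i7.
    - exact: integrableZl_EFin.
    - by move=> w _; exact: trunc_at_mul_error.
  rewrite RintegralZl// RintegralZl// RintegralD//; [|exact: (i4 _ Mu)|exact: (i4 _ Mv)].
  rewrite mulrC ler_pM2r ?invr_gt0 ?exprn_gt0//.
  by have := u4 n n0; have := v4 n n0; lra.
have lim_err (k : nat) :
  `|L - \int[P0]_w (trunc_at k.+1%:R (u0 w) * trunc_at k.+1%:R (v0 w))| <= 4 * K / k.+1%:R ^+ 2.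
  apply: (cvgr_to_le (cvg_norm (cvgB (cvg_cst L) (uv_cvg k)))).
  by exists 1%N => // n /= n0; exact: err.
have c1 := Rintegral_trunc_mul_cvg P0 u0 v0 u0m v0m u02 v02.
have c2 : (fun k : nat => 4 * K / k.+1%:R ^+ 2) @ \oo --> (0 : R).
  have -> : (fun k : nat => 4 * K / k.+1%:R ^+ 2) =
      (fun k => 4 * K * (harmonic k * harmonic k)) :> (nat -> R).
    by apply/funext => k; rewrite /harmonic /= -invfM -expr2.
  rewrite [X in _ --> X](_ : 0 = 4 * K * (0 * 0)); last by rewrite !mulr0.
  by apply: cvgM; [exact: cvg_cst|apply: cvgM; exact: cvg_harmonic].
have h := ler_cvg_to (cvg_norm (cvgB (cvg_cst L) c1)) c2 (nearW _ lim_err).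
by apply/esym/eqP; rewrite -subr_eq0 -normr_le0; exact: h.
Qed.

End MomentIdentification.

Section DiscreteIndependence.
Context {R : realType} {d : measure_display} {Om : measurableType d}.
Variables (P : probability Om R) (X : Om -> R).
Hypothesis mX : measurable_fun setT X.

(** Independence says that the law of [X] under [P] restricted to [B] is [P B] times the law of [X].
    One inequality is enough, as it will be applied to a bounded function and to its opposite, both
    shifted to be nonnegative. *)
Lemma ge0_integral_indep_event_le (B : set Om) (psi : R -> R) :
  measurable B ->
  (forall A, measurable A -> P (X @^-1` A `&` B) = (P (X @^-1` A) * P B)%E) ->
  measurable_fun setT psi -> (forall x, 0 <= psi x) ->
  (P B * \int[P]_w (psi (X w))%:E <= \int[P]_w (psi (X w) * \1_B w)%:E)%E.
Proof.
move=> mB XB mpsi psi0.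
have mpsi' : measurable_fun setT (EFin \o psi) by exact/measurable_EFinP.
pose X' : {RV P >-> R} := mfun_Sub (mem_set mX).
have [nu [nuE nuI]] : exists nu : {measure set (R : measurableType _) -> \bar R},
    (forall A, nu A = P (X @^-1` A `&` B)) /\
    (\int[nu]_x (psi x)%:E = \int[mrestr P mB]_w (psi (X w))%:E)%E.
  unshelve eexists [the measure _ _ of pushforward (mrestr P mB) X]; first exact: mX.
  split; first by [].
  by rewrite ge0_integral_pushforward// => x _; rewrite lee_fin.
pose k : {nonneg R} := NngNum (fine_ge0 (measure_ge0 P B)).
have kE : P B = k%:num%:E by rewrite /= fineK//; exact: fin_num_measure.
apply: (@le_trans _ _ (\int[nu]_x (psi x)%:E)%E); last first.
  rewrite nuI.
  apply: (@ge0_integral_density_le _ _ _ P (mrestr P mB) (\1_B) (psi \o X)) => //.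
  - by move=> A mA; rewrite integral_indic// setIC.
  - exact: measurableT_comp.
  - by move=> w; exact: psi0.
have -> : (\int[nu]_x (psi x)%:E = \int[mscale k (distribution P X')]_x (psi x)%:E)%E.
  by apply: eq_measure_integral => A mA _; rewrite nuE XB// muleC kE.
rewrite ge0_integral_mscale//; last by move=> x _; rewrite lee_fin.
rewrite ge0_integral_distribution//.
by rewrite kE.
Qed.

Lemma Rintegral_indep_event (B : set Om) (phi : R -> R) (M : R) :
  measurable B ->
  (forall A, measurable A -> P (X @^-1` A `&` B) = (P (X @^-1` A) * P B)%E) ->
  measurable_fun setT phi -> (forall x, `|phi x| <= M) ->
  \int[P]_w (phi (X w) * \1_B w) = \int[P]_w phi (X w) * fine (P B).
Proof.
move=> mB XB mphi phiM.
have mphiX : measurable_fun setT (fun w => phi (X w)) by exact: measurableT_comp.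
have mI : measurable_fun setT (\1_B : Om -> R) by exact: measurable_indic.
have I1 w : `|\1_B w : R| <= 1.
  by rewrite indicE; case: (_ \in _); rewrite ?normr1 ?normr0.
have iphi : P.-integrable setT (EFin \o (fun w => phi (X w))).
  exact: (@bounded_integrable _ _ _ P _ M).
have iB : P.-integrable setT (EFin \o (\1_B : Om -> R)).
  exact: (@bounded_integrable _ _ _ P _ 1).
have ipB : P.-integrable setT (EFin \o (fun w => phi (X w) * \1_B w)).
  apply: (@bounded_integrable _ _ _ P _ (M * 1)); first exact: measurable_funM.
  by move=> w; rewrite normrM ler_pM.
have PB : (fine (P B))%:E = P B by rewrite fineK//; exact: fin_num_measure.
(* both M + phi and M - phi are nonnegative, so the inequality holds in both directions *)
have key (e : R) : `|e| = 1 ->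
    fine (P B) * (M + e * \int[P]_w phi (X w)) <=
    M * fine (P B) + e * \int[P]_w (phi (X w) * \1_B w).
  move=> e1; pose psi x := M + e * phi x.
  have psi0 x : 0 <= psi x.
    have : `|e * phi x| <= M by rewrite normrM e1 mul1r.
    by rewrite /psi ler_norml; lra.
  have mpsi : measurable_fun setT psi.
    apply: measurable_funD; first exact: measurable_cst.
    by apply: measurable_funM => //; exact: measurable_cst.
  have := ge0_integral_indep_event_le B psi mB XB mpsi psi0.
  have i1 : P.-integrable setT (EFin \o (fun w => psi (X w))).
    apply: integrableD_EFin; first exact: finite_measure_integrable_cst.
    exact: integrableZl_EFin.
  have i2 : P.-integrable setT (EFin \o (fun w => psi (X w) * \1_B w)).
    have -> : (fun w => psi (X w) * \1_B w) =
      (fun w => M * \1_B w + e * (phi (X w) * \1_B w)).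
      by apply/funext => w; rewrite /psi; ring.
    by apply: integrableD_EFin; exact: integrableZl_EFin.
  rewrite -PB -(fineK (integrable_fin_num measurableT i1)).
  rewrite -(fineK (integrable_fin_num measurableT i2)) -EFinM lee_fin.
  rewrite -/(Rintegral _ _ _) -/(Rintegral _ _ _).
  have -> : \int[P]_w (psi (X w)) = M + e * \int[P]_w phi (X w).
    rewrite /psi RintegralD//; last exact: integrableZl_EFin.
    by rewrite Rintegral_prob_cst RintegralZl.
    exact: finite_measure_integrable_cst.
  have -> : \int[P]_w (psi (X w) * \1_B w) =
      M * fine (P B) + e * \int[P]_w (phi (X w) * \1_B w).
    rewrite (@eq_Rintegral _ _ _ _ _ (fun w => M * \1_B w + e * (phi (X w) * \1_B w))).
      rewrite RintegralD//; [|exact: integrableZl_EFin|exact: integrableZl_EFin].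
      by rewrite RintegralZl// RintegralZl// Rintegral_indic.
    by move=> w _; rewrite /psi; ring.
  by [].
have k1 := key 1 (normr1 _).
have k2 := key (-1) ltac:(by rewrite normrN1).
rewrite [RHS]mulrC; apply/eqP; rewrite eq_le; apply/andP; split.
  by move: k2; rewrite mulrDr !mulN1r mulrN (mulrC M) lerD2l lerN2.
by move: k1; rewrite mulrDr !mul1r (mulrC M) lerD2l.
Qed.

(** As [N] takes finitely many values, [psi (N w)%:R] is a finite combination of indicators, and the
    factorisation holds event by event. *)
Lemma Rintegral_indep_discrete (n : nat) (N : Om -> nat) (phi psi : R -> R) (M : R) :
  (forall w, (N w <= n)%N) -> measurable_fun setT (fun w => (N w)%:R : R) ->
  (forall A B : set R, measurable A -> measurable B ->
    P (X @^-1` A `&` (fun w => (N w)%:R : R) @^-1` B) =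
    (P (X @^-1` A) * P ((fun w => ((N w)%:R : R)%R) @^-1` B))%E) ->
  measurable_fun setT phi -> (forall x, `|phi x| <= M) ->
  \int[P]_w (phi (X w) * psi (N w)%:R) =
  \int[P]_w phi (X w) * \int[P]_w psi (N w)%:R.
Proof.
move=> Nn mN XN mphi phiM.
pose B (m : nat) : set Om := (fun w => (N w)%:R : R) @^-1` [set m%:R].
have mB m : measurable (B m) by rewrite -[B m]setTI; exact: mN.
have mphiX : measurable_fun setT (fun w => phi (X w)) by exact: measurableT_comp.
have psiE w : psi (N w)%:R = \sum_(m < n.+1) psi m%:R * \1_(B m) w.
  have Nw : (N w < n.+1)%N by rewrite ltnS.
  rewrite (bigD1 (Ordinal Nw))//= big1 ?addr0.
    by rewrite indicE mem_set// mulr1.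
  move=> m /eqP mN'; rewrite indicE memNset ?mulr0//.
  by move=> /eqP; rewrite eqr_nat => /eqP h; apply: mN'; apply/val_inj.
have I1 m w : `|\1_(B m) w : R| <= 1.
  by rewrite indicE; case: (_ \in _); rewrite ?normr1 ?normr0.
have iB m : P.-integrable setT (EFin \o (\1_(B m) : Om -> R)).
  by apply: (@bounded_integrable _ _ _ P _ 1) => //; exact: measurable_indic.
have ipB m : P.-integrable setT (EFin \o (fun w => phi (X w) * \1_(B m) w)).
  apply: (@bounded_integrable _ _ _ P _ (M * 1)).
    by apply: measurable_funM => //; exact: measurable_indic.
  by move=> w; rewrite normrM ler_pM.
have E1 w : phi (X w) * psi (N w)%:R =
    \sum_(m < n.+1) psi m%:R * (phi (X w) * \1_(B m) w).
  by rewrite psiE mulr_sumr; apply: eq_bigr => m _; ring.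
under eq_Rintegral do rewrite E1.
under [X in _ = _ * X]eq_Rintegral do rewrite psiE.
rewrite Rintegral_sum; last by move=> m; exact: integrableZl_EFin.
rewrite Rintegral_sum; last by move=> m; exact: integrableZl_EFin.
rewrite mulr_sumr; apply: eq_bigr => m _.
rewrite RintegralZl// RintegralZl// Rintegral_indic//.
rewrite (Rintegral_indep_event (B m) phi M)//; first by ring.
by move=> A mA; exact: XN.
Qed.

End DiscreteIndependence.

(** * The embedded chain *)

Section RealMoments.
Context {R : realType} {d : measure_display} {Om : measurableType d}.
Variable P : probability Om R.

Lemma expectation_Rintegral (u : Om -> R) : P.-integrable setT (EFin \o u) ->
  ('E_P[u] = (\int[P]_w u w)%:E)%E.
Proof.
move=> iu; rewrite unlock /Rintegral fineK//; exact: integrable_fin_num.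
Qed.

Lemma covariance_Rintegral (u v : Om -> R) :
  measurable_fun setT u -> measurable_fun setT v ->
  P.-integrable setT (EFin \o (fun w => u w ^+ 2)) ->
  P.-integrable setT (EFin \o (fun w => v w ^+ 2)) ->
  covariance P u v =
    (\int[P]_w (u w * v w) - \int[P]_w u w * \int[P]_w v w)%:E.
Proof.
move=> mu mv iu iv.
have iu1 := sq_integrable P u mu iu; have iv1 := sq_integrable P v mv iv.
have iuv := sq_integrable_mul P u v mu mv iu iv.
rewrite covarianceE; [|exact/Lfun1_integrable..].
by rewrite !expectation_Rintegral// EFinB EFinM.
Qed.

End RealMoments.

Lemma nbhs_infty_sqrtr_gt {R : realType} (x : R) :
  \forall n \near \oo, x < Num.sqrt (n%:R : R).
Proof.
have : \forall n \near \oo, x ^+ 2 < n%:R by exact: nbhs_infty_gtr.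
apply: filterS => n xn; have n0 : 0 < n%:R :> R by apply: le_lt_trans xn; exact: sqr_ge0.
apply: (le_lt_trans (ler_norm x)).
by rewrite -sqrtr_sqr ltr_sqrt.
Qed.

Section EvaluationFunctionals.
Context {R : realType}.
Variables (c : R) (fp : R -> R).

(** A 1-Lipschitz condition in uniform distance, shared by the coordinates of both paths and by
    constants; the constant 1 lets means be treated as mixed second moments. *)
Definition evaluation_like (al : (R -> R^o) -> (R -> (R * R)) -> R) :=
  forall (p : R -> (R * R)) x q d, 0 < d ->
    (forall t, 0 <= t <= 1 -> `|x t - shear c fp p t| < d) ->
    (forall t, 0 <= t <= 1 -> `|q t - p t| < d) ->
    `|al x q - al (shear c fp p) p| <= d.

Lemma evaluation_like_left s : 0 <= s <= 1 -> evaluation_like (fun x _ => x s).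
Proof. by move=> s01 p x q d _ xp _; exact/ltW/xp. Qed.

Lemma evaluation_like_right s : 0 <= s <= 1 -> evaluation_like (fun _ q => (q s).2).
Proof.
move=> s01 p x q d _ _ qp; apply: le_trans (ltW (qp s s01)).
by rewrite [leRHS]prod_normE le_max /= lexx orbT.
Qed.

Lemma evaluation_like_cst r : evaluation_like (fun _ _ => r).
Proof. by move=> p x q d d0 _ _; rewrite subrr normr0 ltW. Qed.

Lemma trunc_mul_admissible (k : R) al be : 0 < k ->
  evaluation_like al -> evaluation_like be ->
  shear_admissible c fp (fun x q => trunc_at k (al x q) * trunc_at k (be x q)).
Proof.
move=> k0 hal hbe p _ e e0; exists (e / (2 * k)); first by rewrite divr_gt0// mulr_gt0.
set d := e / _; have d0 : 0 < d by rewrite divr_gt0// mulr_gt0.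
move=> x q _ xp qp; set A := al x q; set B := be x q.
set A' := al (shear c fp p) p; set B' := be (shear c fp p) p.
have hA : `|trunc_at k A - trunc_at k A'| <= d.
  by apply: (le_trans (trunc_at_lip _ _ _)); exact: hal.
have hB : `|trunc_at k B - trunc_at k B'| <= d.
  by apply: (le_trans (trunc_at_lip _ _ _)); exact: hbe.
have -> : trunc_at k A * trunc_at k B - trunc_at k A' * trunc_at k B' =
  (trunc_at k A - trunc_at k A') * trunc_at k B +
  trunc_at k A' * (trunc_at k B - trunc_at k B') by ring.
have ed : e = d * k + k * d by rewrite /d; field; rewrite gt_eqF.
rewrite [leRHS]ed; apply: (le_trans (ler_normD _ _)); rewrite !normrM.
by apply: lerD; apply: ler_pM => //; apply: trunc_at_le; exact: ltW.
Qed.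

End EvaluationFunctionals.

Section EmbeddedChain.
Context {R : realType}
  (dn : nat -> measure_display) (Om : forall n, measurableType (dn n))
  (P : forall n, probability (Om n) R)
  (T : forall n, 'I_n -> Om n -> R)
  (Xd : forall n, nat -> Om n -> R)
  (a b : nat -> R) (f fp : R -> R) (c : R)
  (d0 : measure_display) (Om0 : measurableType d0) (P0 : probability Om0 R)
  (Z W : R -> Om0 -> R).
Hypothesis hT : forall n, (0 < n)%N ->
  (forall i, uniform01 (P n) (T n i)) /\ mutually_independent (P n) (T n).
Hypothesis hX : forall n, (0 < n)%N ->
  (forall k, (k <= n)%N -> measurable_fun setT (Xd n k)) /\
  independent_families (P n) (fun k : 'I_n.+1 => Xd n k)
    (fun t : R => fun w => (count_proc (T n) t w)%:R).
Hypothesis ab0 : forall n, (0 < n)%N -> 0 < a n /\ 0 < b n.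
Hypothesis fc : {within `[0, 1], continuous f}.
Hypothesis fd : forall t, 0 < t < 1 -> derivable f t 1 /\ (f^`())%classic t = fp t.
Hypothesis fpc : {within `[0, 1], continuous fp}.
Hypothesis ZWg : gaussian_process2 P0 Z W.
Hypothesis ZWc : as_continuous P0 (fun w t => (Z t w, W t w)).
Hypothesis XZW : cvg_dist_D P
    (fun n w t => (a n * (Xd n (count_proc (T n) t w) w - b n * f t),
                   ((count_proc (T n) t w)%:R - n%:R * t) / Num.sqrt n%:R))
    P0 (fun w t => (Z t w, W t w)).
Hypothesis c0 : 0 <= c.
Hypothesis abc : (fun n => a n * b n / Num.sqrt n%:R) @ \oo --> c.

Let X n w : R -> (R * R) := counting_path f (a n) (b n) n (fun k => Xd n k w)
  (fun t => count_proc (T n) t w).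
Let y n w : R -> R^o := floor_path f (a n) (b n) n (fun k => Xd n k w).
Let Y w : R -> (R * R) := fun t => (Z t w, W t w).
Let Zd t w := Z t w - c * fp t * W t w.

Let fp_bounded : exists2 B, 0 <= B & forall t, 0 <= t <= 1 -> `|fp t| <= B.
Proof.
have [B HB] := unif_cont_bounded _ (within01_unif_cont _ fpc).
by exists B => //; apply: le_trans (HB 0 _); rewrite ?lexx ?ler01.
Qed.

Lemma eventually_shear_rel (B : R) : 0 <= B ->
  (forall t, 0 <= t <= 1 -> `|fp t| <= B) -> forall m, \forall n \near \oo,
  {ae P n, forall w, cadlag (y n w) /\ shear_rel c B fp m (X n w) (y n w)}.
Proof.
move=> B0 fpB m.
(* The error condition of [floor_path_shear_rel] has three summands; each receives a third of the
   tolerance [m.+1%:R^-1]. *)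
pose mm : R := m.+1%:R; pose th : R := m.+1%:R^-1 / 3.
have mm0 : 0 < mm by rewrite /mm ltr0n.
have th0 : 0 < th by rewrite divr_gt0// invr_gt0.
pose v0 := th / (c * mm + 1).
have cm0 : 0 < c * mm + 1 by rewrite ltr_wpDl// mulr_ge0// ltW.
have v00 : 0 < v0 by rewrite divr_gt0.
have [e e0 eP] := within01_unif_cont _ fpc v0 v00.
pose g := Num.min e m.+1%:R^-1.
have g0 : 0 < g by rewrite lt_min e0 invr_gt0 ltr0n.
(* The bound 1 gives [cn <= c + 1] for the rounding term; the other bound controls the term with
   [cn - c]. *)
pose eta := Num.min 1 (th / (B * mm + 1)).
have Bm0 : 0 < B * mm + 1 by rewrite ltr_wpDl// mulr_ge0// ltW.
have eta0 : 0 < eta by rewrite lt_min ltr01 divr_gt0.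
have abc' := abc; move/cvgrPdist_lt : abc' => /(_ _ eta0) Hc.
near=> n.
have n0 : (0 < n)%N by near: n; exact: nbhs_infty_gt.
have big1' : (mm + 1) / g < Num.sqrt n%:R by near: n; exact: nbhs_infty_sqrtr_gt.
have big2 : (c + 1) * B / th < Num.sqrt n%:R by near: n; exact: nbhs_infty_sqrtr_gt.
have Hn : `|c - a n * b n / Num.sqrt n%:R| < eta by near: n; exact: Hc.
have [a0 b0] := ab0 n n0; have [Tu Ti] := hT n n0.
have := uniform_sample_ae_distinct (P n) n (T n) Tu Ti.
apply: filterS => w [Tinj T01]; split; first exact: floor_path_cadlag.
have n0' : 0 < n%:R :> R by rewrite ltr0n.
pose r := Num.sqrt (n%:R : R).
have r0 : 0 < r by rewrite sqrtr_gt0.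
have r1 : 1 <= r by rewrite -[1]sqrtr1 ler_wsqrtr// ler1n.
have rr : r * r = n%:R by rewrite -expr2 sqr_sqrtr// ltW.
rewrite -/r in big1' big2 Hn.
have Dg : mm / r + n%:R^-1 < g.
  apply: (@le_lt_trans _ _ ((mm + 1) / r)).
    rewrite mulrDl lerD2l mul1r lef_pV2 ?posrE// -rr ler_peMr//; exact: ltW.
  by rewrite ltr_pdivrMr// mulrC -ltr_pdivrMr.
move: (Dg); rewrite lt_min => /andP[De Dm].
move: (Hn); rewrite lt_min => /andP[cn1 cn2].
apply: (floor_path_shear_rel f fp fc fd c B c0 fpB (a n) (b n) n m _ _
  (mm / r + n%:R^-1) v0) => //.
- exact: count_proc_surj.
- exact: ltW.
- by move=> s t s01 t01 st; apply/ltW/eP => //; exact: le_lt_trans De.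
rewrite -/r -/mm; set cn := a n * b n / r in Hn cn1 cn2 *.
have t1 : `|cn - c| * (B * mm) <= th.
  rewrite distrC; apply: (@le_trans _ _ (th / (B * mm + 1) * (B * mm))).
    by rewrite ler_wpM2r ?mulr_ge0// ltW.
  by rewrite mulrAC ler_pdivrMr// ler_pM2l// lerDl.
have t2 : c * (v0 * mm) <= th.
  have -> : c * (v0 * mm) = th * (c * mm) / (c * mm + 1) by rewrite /v0; ring.
  by rewrite ler_pdivrMr// ler_pM2l// lerDl.
have t3 : cn * (B / r) <= th.
  have cnc : cn <= c + 1 by move: cn1; rewrite ltr_norml; move: (cn) => z; lra.
  apply: (@le_trans _ _ ((c + 1) * (B / r))).
    by rewrite ler_wpM2r// divr_ge0// ltW.
  by rewrite mulrA ler_pdivrMr// (mulrC th) -ler_pdivrMr// ltW.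
have -> : m.+1%:R^-1 = th + th + th by rewrite /th; field; rewrite addrC natr1 pnatr_eq0.
by apply: lerD => //; exact: lerD.
Unshelve. all: by end_near. Qed.

Let Z_measurable t : 0 <= t <= 1 -> measurable_fun setT (Z t).
Proof. by have [h _] := ZWg; exact: h. Qed.

Let W_measurable t : 0 <= t <= 1 -> measurable_fun setT (W t).
Proof. by have [_ [h _]] := ZWg; exact: h. Qed.

Let Zd_measurable t : 0 <= t <= 1 -> measurable_fun setT (Zd t).
Proof.
move=> t01; apply: measurable_funB; first exact: Z_measurable.
by apply: measurable_funM; [exact: measurable_cst|exact: W_measurable].
Qed.

Lemma embedded_mapping (M : R) K : (forall x q, `|K x q| <= M) ->
  shear_admissible c fp K ->
  (fun n => (\int[P n]_w (K (y n w) (X n w))%:E)%E) @ \oo -->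
  (\int[P0]_w (K (shear c fp (Y w)) (Y w))%:E)%E.
Proof.
move=> KM Kc; have [B B0 fpB] := fp_bounded.
apply: (shear_mapping dn Om P X d0 Om0 P0 Y XZW ZWc _ _ c B fp y c0 B0 fpB fpc _ M K KM Kc).
- exact: Z_measurable.
- exact: W_measurable.
- exact: eventually_shear_rel.
Qed.

Lemma embedded_cvg_dist_D : cvg_dist_D P
    (fun n w t => (a n * (Xd n (Num.truncn (n%:R * t)) w - b n * f t) : R^o))
    P0 (fun w t => (Zd t w : R^o)).
Proof.
move=> F [M FM] Fc; have [B B0 fpB] := fp_bounded.
apply: (embedded_mapping M (fun x _ => F x)) => // p pc e e0.
have hc := shear_cadlag c B fp c0 B0 fpB fpc p pc.
have [dd dd0 H] := skorohod_continuous_unif F _ e Fc hc e0.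
by exists dd => // x q xc xp _; exact: H.
Qed.

Lemma embedded_limit_continuous : as_continuous P0 (fun w t => (Zd t w : R^o)).
Proof.
have [B B0 fpB] := fp_bounded.
move: ZWc; apply: filterS => w /within01_unif_cont Yw.
apply/within01_continuousP => t t01 e e0.
have [dd dd0 H] := shear_unif_cont c B fp c0 B0 fpB (Y w) fpc Yw e e0.
by exists dd => // s s01; exact: H.
Qed.

Lemma embedded_limit_gaussian : gaussian_process P0 Zd.
Proof.
split=> [|s s01]; first exact: Zd_measurable.
have [_ [_ G]] := ZWg.
have := G [seq (p.1, (p.2, - (p.2 * (c * fp p.1)))) | p <- s].
rewrite all_map => /(_ s01).
set u := (X in gaussian_rv _ X -> _); set v := (X in _ -> gaussian_rv _ X).
suff -> : u = v by [].
apply/funext => w; rewrite /u /v big_map; apply: eq_bigr => p _ /=.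
by rewrite /Zd; ring.
Qed.

(** * First and second moments of the limit processes *)

Let Z_sq t : 0 <= t <= 1 -> P0.-integrable setT (EFin \o (fun w => Z t w ^+ 2)).
Proof.
move=> t01; apply: gaussian_rv_sq_integrable; first exact: Z_measurable.
have [_ [_ G]] := ZWg; have := G [:: (t, (1, 0))]; rewrite /= t01 => /(_ isT).
set u := (X in gaussian_rv _ X -> _); suff -> : u = Z t by [].
by apply/funext => w; rewrite /u big_seq1 /= mul1r mul0r addr0.
Qed.

Let W_sq t : 0 <= t <= 1 -> P0.-integrable setT (EFin \o (fun w => W t w ^+ 2)).
Proof.
move=> t01; apply: gaussian_rv_sq_integrable; first exact: W_measurable.
have [_ [_ G]] := ZWg; have := G [:: (t, (0, 1))]; rewrite /= t01 => /(_ isT).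
set u := (X in gaussian_rv _ X -> _); suff -> : u = W t by [].
by apply/funext => w; rewrite /u big_seq1 /= mul1r mul0r add0r.
Qed.

Let Zd_sq t : 0 <= t <= 1 -> P0.-integrable setT (EFin \o (fun w => Zd t w ^+ 2)).
Proof.
move=> t01; apply: gaussian_rv_sq_integrable; first exact: Zd_measurable.
have [_ G] := embedded_limit_gaussian; have := G [:: (t, 1)]; rewrite /= t01 => /(_ isT).
set u := (X in gaussian_rv _ X -> _); suff -> : u = Zd t by [].
by apply/funext => w; rewrite /u big_seq1 /= mul1r.
Qed.

Lemma embedded_trunc_mul_cvg (k : nat) al be :
  evaluation_like c fp al -> evaluation_like c fp be ->
  measurable_fun setT (fun w => al (shear c fp (Y w)) (Y w)) ->
  measurable_fun setT (fun w => be (shear c fp (Y w)) (Y w)) ->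
  (fun n => \int[P n]_w (trunc_at k.+1%:R (al (y n w) (X n w)) *
                         trunc_at k.+1%:R (be (y n w) (X n w)))) @ \oo -->
  \int[P0]_w (trunc_at k.+1%:R (al (shear c fp (Y w)) (Y w)) *
              trunc_at k.+1%:R (be (shear c fp (Y w)) (Y w))).
Proof.
move=> hal hbe mal mbe.
have k0 : 0 < k.+1%:R :> R by [].
have KM x q : `|trunc_at k.+1%:R (al x q) * trunc_at k.+1%:R (be x q)| <=
    k.+1%:R * k.+1%:R :> R.
  by rewrite normrM ler_pM// trunc_at_le.
have := embedded_mapping _ _ KM (trunc_mul_admissible c fp _ al be k0 hal hbe).
move=> cv; apply: fine_cvg; rewrite /Rintegral fineK//.
apply: integrable_fin_num => //.
apply: (@bounded_integrable _ _ _ P0 _ (k.+1%:R * k.+1%:R)) => //.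
by apply: measurable_funM; exact: measurable_trunc_at.
Qed.

(** The added 1 makes [K4] also a bound for the fourth moment of the constant 1. *)
Let K4 : R := 2 * (16 * 4`!%:R) * expR 1 + 1.

Lemma normalized_count_le_K4 n t : (0 < n)%N -> 0 <= t <= 1 ->
  \int[P n]_w (normalized_count n (T n) t w ^+ 4) <= K4.
Proof.
move=> n0 t01; have [Tu Ti] := hT n n0.
apply: (le_trans (Rintegral_normalized_count4 (P n) n (T n) Tu Ti n0 t t01)).
by rewrite lerDl.
Qed.

Lemma W_mean t : 0 <= t <= 1 -> \int[P0]_w W t w = 0.
Proof.
move=> t01.
(* The mean is the mixed second moment with the constant 1. *)
have := second_moment_limit dn Om P d0 Om0 P0
  (fun n => normalized_count n (T n) t) (fun n => cst 1) (W t) (cst 1) 0 K4.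
have -> : (fun w => W t w * cst 1 w) = W t by apply/funext => w; rewrite /= mulr1.
apply.
- move=> n n0; have [Tu Ti] := hT n n0; exact: (measurable_normalized_count (P n)).
- by move=> n n0; exact: measurable_cst.
- move=> n n0; exists (Num.sqrt n%:R) => w; exact: normalized_count_bounded.
- by move=> n n0; exists 1 => w; rewrite /= normr1.
- by move=> n n0; exact: normalized_count_le_K4.
- move=> n n0; rewrite /cst expr1n Rintegral_prob_cst /K4 lerDr.
  by rewrite !mulr_ge0// expR_ge0.
- move=> n n0; under eq_Rintegral do rewrite mulr1.
  by have [Tu Ti] := hT n n0; exact: Rintegral_normalized_count.
- exact: W_measurable.
- exact: measurable_cst.
- exact: W_sq.
- rewrite (_ : (fun w => cst 1 w ^+ 2) = cst (1 : R)).
    exact: finite_measure_integrable_cst.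
  by apply/funext => w /=; rewrite expr1n.
- move=> k; apply: (embedded_trunc_mul_cvg k (fun _ q => (q t).2) (fun _ _ => 1)).
  + exact: evaluation_like_right.
  + exact: evaluation_like_cst.
  + exact: W_measurable.
  + exact: measurable_cst.
Qed.

Lemma W_second_moment s t : 0 <= s -> s <= t -> t <= 1 ->
  \int[P0]_w (W s w * W t w) = s * (1 - t).
Proof.
move=> s0 st t1.
have s01 : 0 <= s <= 1 by rewrite s0 (le_trans st).
have t01 : 0 <= t <= 1 by rewrite t1 (le_trans s0 st).
apply: (second_moment_limit dn Om P d0 Om0 P0
  (fun n => normalized_count n (T n) s) (fun n => normalized_count n (T n) t)
  (W s) (W t) _ K4).
- move=> n n0; have [Tu Ti] := hT n n0; exact: (measurable_normalized_count (P n)).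
- move=> n n0; have [Tu Ti] := hT n n0; exact: (measurable_normalized_count (P n)).
- move=> n n0; exists (Num.sqrt n%:R) => w; exact: normalized_count_bounded.
- move=> n n0; exists (Num.sqrt n%:R) => w; exact: normalized_count_bounded.
- by move=> n n0; exact: normalized_count_le_K4.
- by move=> n n0; exact: normalized_count_le_K4.
- move=> n n0; have [Tu Ti] := hT n n0; exact: Rintegral_normalized_count_mul.
- exact: W_measurable.
- exact: W_measurable.
- exact: W_sq.
- exact: W_sq.
- move=> k; apply: (embedded_trunc_mul_cvg k (fun _ q => (q s).2) (fun _ q => (q t).2)).
  + exact: evaluation_like_right.
  + exact: evaluation_like_right.
  + exact: W_measurable.
  + exact: W_measurable.
Qed.

(** At time [s] the embedded path reads one variable [Xd n j] with a deterministic index [j], while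
    the second coordinate at [t] reads only the count at [t]. The factors truncating 1 equal 1 and
    match the form of [embedded_trunc_mul_cvg]. *)
Lemma prelimit_independent (k n : nat) s t : (0 < n)%N -> 0 <= s <= 1 -> 0 <= t <= 1 ->
  \int[P n]_w (trunc_at k.+1%:R (y n w s) * trunc_at k.+1%:R (X n w t).2) =
  \int[P n]_w (trunc_at k.+1%:R (y n w s) * trunc_at k.+1%:R 1) *
  \int[P n]_w (trunc_at k.+1%:R (X n w t).2 * trunc_at k.+1%:R 1).
Proof.
move=> n0 /andP[s0 s1] t01; have [Tu Ti] := hT n n0; have [mXd XN] := hX n n0.
have T1 : trunc_at k.+1%:R 1 = 1 :> R by rewrite trunc_at_id// normr1 ler1n.
rewrite T1; under [X in _ = X * _]eq_Rintegral do rewrite mulr1.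
under [X in _ = _ * X]eq_Rintegral do rewrite mulr1.
pose j := Num.truncn (n%:R * s).
have jn : (j < n.+1)%N.
  have /andP[j1 _] : j%:R <= n%:R * s < j.+1%:R by apply: truncn_itv; rewrite mulr_ge0.
  by rewrite ltnS -(ler_nat R); apply: (le_trans j1); rewrite ler_piMr.
apply: (Rintegral_indep_discrete (P n) (Xd n j) _ n (count_proc (T n) t)
  (fun x => trunc_at k.+1%:R (a n * (x - b n * f s)))
  (fun r => trunc_at k.+1%:R ((r - n%:R * t) / Num.sqrt n%:R)) k.+1%:R).
- exact: mXd.
- by move=> w; exact: count_proc_le.
- exact: (measurable_count_proc (P n)).
- move=> A B mA mB.
  have := XN [set Ordinal jn] [set t] (fun=> A) (fun=> B) (finite_set1 _) (finite_set1 _)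
    (fun=> mA) (fun=> mB).
  by rewrite !bigcap_set1.
- apply: measurable_trunc_at; apply: measurable_funM; first exact: measurable_cst.
  by apply: measurable_funB; [exact: measurable_id|exact: measurable_cst].
- by move=> x; exact: trunc_at_le.
Qed.

(* the embedded chain is independent of N, hence its limit is uncorrelated with W *)
Lemma embedded_limit_uncorrelated s t : 0 <= s <= 1 -> 0 <= t <= 1 ->
  \int[P0]_w (Zd s w * W t w) = 0.
Proof.
move=> s01 t01.
have one_sq : P0.-integrable setT (EFin \o (fun w => (cst 1 w : R) ^+ 2)).
  rewrite (_ : (fun w => cst 1 w ^+ 2) = cst (1 : R)).
    exact: finite_measure_integrable_cst.
  by apply/funext => w /=; rewrite expr1n.
have mW := W_measurable t t01; have mZd := Zd_measurable s s01.
have m1 : measurable_fun setT (cst 1 : Om0 -> R) by exact: measurable_cst.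
(* The factorisation survives [n] going to infinity at each truncation level. Letting the level grow
   then gives the product of the means of [Zd s] and [W t], and the latter is zero. *)
have fact (k : nat) :
  \int[P0]_w (trunc_at k.+1%:R (Zd s w) * trunc_at k.+1%:R (W t w)) =
  \int[P0]_w (trunc_at k.+1%:R (Zd s w) * trunc_at k.+1%:R (cst 1 w)) *
  \int[P0]_w (trunc_at k.+1%:R (W t w) * trunc_at k.+1%:R (cst 1 w)).
  have el := evaluation_like_left c fp s s01.
  have er := evaluation_like_right c fp t t01.
  have e1 := evaluation_like_cst c fp 1.
  have cv1 := embedded_trunc_mul_cvg k _ _ el er mZd mW.
  have cv2 := embedded_trunc_mul_cvg k _ _ el e1 mZd m1.
  have cv3 := embedded_trunc_mul_cvg k _ _ er e1 mW m1.
  apply: (@cvg_unique _ (@Rhausdorff R) _ _ _ _ cv1).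
  apply: cvg_trans (cvgM cv2 cv3); apply: near_eq_cvg.
  by exists 1%N => // n /= n0; rewrite prelimit_independent.
have l1 := Rintegral_trunc_mul_cvg P0 _ _ mZd mW (Zd_sq s s01) (W_sq t t01).
have l2 := Rintegral_trunc_mul_cvg P0 _ _ mZd m1 (Zd_sq s s01) one_sq.
have l3 := Rintegral_trunc_mul_cvg P0 _ _ mW m1 (W_sq t t01) one_sq.
have EW : \int[P0]_w (W t w * cst 1 w) = 0.
  by under eq_Rintegral do rewrite mulr1; exact: W_mean.
rewrite EW in l3.
rewrite -(mulr0 (\int[P0]_w (Zd s w * cst 1 w))).
apply: (@cvg_unique _ (@Rhausdorff R) _ _ _ _ l1); apply: cvg_trans (cvgM l2 l3).
by apply: near_eq_cvg; apply: nearW => k; rewrite fact.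
Qed.

Let W_int t (t01 : 0 <= t <= 1) : P0.-integrable setT (EFin \o W t).
Proof. exact: sq_integrable (W_measurable t t01) (W_sq t t01). Qed.

Let Z_int t (t01 : 0 <= t <= 1) : P0.-integrable setT (EFin \o Z t).
Proof. exact: sq_integrable (Z_measurable t t01) (Z_sq t t01). Qed.

Lemma embedded_limit_mean t : 0 <= t <= 1 -> \int[P0]_w Zd t w = \int[P0]_w Z t w.
Proof.
move=> t01; rewrite RintegralB//; [|exact: Z_int|exact: integrableZl_EFin (W_int t t01)].
by rewrite RintegralZl//; [rewrite W_mean// mulr0 subr0|exact: W_int].
Qed.

Lemma embedded_limit_expectation t : 0 <= t <= 1 ->
  ('E_P0[Zd t] = 'E_P0[Z t])%E.
Proof.
move=> t01; rewrite (expectation_Rintegral _ _ (Z_int t t01)).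
rewrite expectation_Rintegral; last first.
  exact: sq_integrable (Zd_measurable t t01) (Zd_sq t t01).
by rewrite embedded_limit_mean.
Qed.

Lemma embedded_limit_covariance s t : 0 <= s -> s <= t -> t <= 1 ->
  covariance P0 (Zd s) (Zd t) =
     (covariance P0 (Z s) (Z t) - (c ^+ 2 * s * (1 - t) * fp s * fp t)%:E)%E.
Proof.
move=> s0 st t1.
have s01 : 0 <= s <= 1 by rewrite s0 (le_trans st).
have t01 : 0 <= t <= 1 by rewrite t1 (le_trans s0 st).
rewrite !covariance_Rintegral; do ?[exact: Z_measurable|exact: Zd_measurable|
  exact: Z_sq|exact: Zd_sq].
rewrite !embedded_limit_mean// -EFinB; congr EFin.
have i1 : P0.-integrable setT (EFin \o (fun w => Zd s w * Zd t w)).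
  by apply: sq_integrable_mul; do ?[exact: Zd_measurable|exact: Zd_sq].
have i2 : P0.-integrable setT (EFin \o (fun w => Zd s w * W t w)).
  by apply: sq_integrable_mul; do ?[exact: Zd_measurable|exact: Zd_sq|exact: W_measurable|exact: W_sq].
have i3 : P0.-integrable setT (EFin \o (fun w => Zd t w * W s w)).
  by apply: sq_integrable_mul; do ?[exact: Zd_measurable|exact: Zd_sq|exact: W_measurable|exact: W_sq].
have i4 : P0.-integrable setT (EFin \o (fun w => W s w * W t w)).
  by apply: sq_integrable_mul; do ?[exact: W_measurable|exact: W_sq].
(* Expand [Z = Zd + c f' W]: the two cross terms vanish and the last one is the Brownian bridge
   covariance. The products of means already agree on both sides. *)
have E : \int[P0]_w (Z s w * Z t w) = \int[P0]_w (Zd s w * Zd t w) +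
    c * fp t * \int[P0]_w (Zd s w * W t w) +
    c * fp s * \int[P0]_w (Zd t w * W s w) +
    c * fp s * (c * fp t) * \int[P0]_w (W s w * W t w).
  rewrite -!RintegralZl// -!RintegralD//; do ?[exact: integrableZl_EFin|
    apply: integrableD_EFin => //].
  by apply: eq_Rintegral => w _; rewrite /Zd; ring.
rewrite E !embedded_limit_uncorrelated// W_second_moment//; ring.
Qed.

End EmbeddedChain.

Theorem mainTheorem6 (R : realType)
  (dn : nat -> measure_display) (Om : forall n, measurableType (dn n))
  (P : forall n, probability (Om n) R)
  (T : forall n, 'I_n -> Om n -> R)
  (Xd : forall n, nat -> Om n -> R)
  (a b : nat -> R) (f fp : R -> R) (c : R)
  (d0 : measure_display) (Om0 : measurableType d0) (P0 : probability Om0 R)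
  (Z W : R -> Om0 -> R) :
  (* T_1..T_n i.i.d. uniform on [0,1] *)
  (forall n, (0 < n)%N ->
     (forall i, uniform01 (P n) (T n i)) /\ mutually_independent (P n) (T n)) ->
  (* (Xd_k)_{k=0..n} is a real process independent of (N(t))_t *)
  (forall n, (0 < n)%N ->
     (forall k, (k <= n)%N -> measurable_fun setT (Xd n k)) /\
     independent_families (P n) (fun k : 'I_n.+1 => Xd n k)
       (fun t : R => fun w => (count_proc (T n) t w)%:R)) ->
  (forall n, (0 < n)%N -> 0 < a n /\ 0 < b n) ->
  (* f is C^1 on [0,1] with derivative fp *)
  {within `[0, 1], continuous f} ->
  (forall t, 0 < t < 1 -> derivable f t 1 /\ (f^`())%classic t = fp t) ->
  {within `[0, 1], continuous fp} ->
  (* (Z,W) is a continuous 2-dimensional Gaussian process *)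
  gaussian_process2 P0 Z W ->
  as_continuous P0 (fun w t => (Z t w, W t w)) ->
  (* joint convergence in D[0,1] *)
  cvg_dist_D P
    (fun n w t => (a n * (Xd n (count_proc (T n) t w) w - b n * f t),
                   ((count_proc (T n) t w)%:R - n%:R * t) / Num.sqrt n%:R))
    P0 (fun w t => (Z t w, W t w)) ->
  0 <= c ->
  (fun n => a n * b n / Num.sqrt n%:R) @ \oo --> c ->
  let Zd := fun t w => Z t w - c * fp t * W t w in
  cvg_dist_D P
    (fun n w t => (a n * (Xd n (Num.truncn (n%:R * t)) w - b n * f t) : R^o))
    P0 (fun w t => (Zd t w : R^o)) /\
  as_continuous P0 (fun w t => (Zd t w : R^o)) /\
  gaussian_process P0 Zd /\
  (forall t, 0 <= t <= 1 -> ('E_P0[Zd t] = 'E_P0[Z t])%E) /\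
  (forall s t, 0 <= s -> s <= t -> t <= 1 ->
     covariance P0 (Zd s) (Zd t) =
     (covariance P0 (Z s) (Z t) - (c ^+ 2 * s * (1 - t) * fp s * fp t)%:E)%E).
Proof.
move=> hT hX ab0 fc fd fpc ZWg ZWc XZW c0 abc Zd; split.
  exact: (embedded_cvg_dist_D dn Om P T Xd a b f fp c d0 Om0 P0 Z W hT ab0 fc fd fpc
    ZWg ZWc XZW c0 abc).
split; first exact: (embedded_limit_continuous fp c d0 Om0 P0 Z W fpc ZWc c0).
split; first exact: (embedded_limit_gaussian fp c d0 Om0 P0 Z W ZWg).
split.
  exact: (embedded_limit_expectation dn Om P T Xd a b f fp c d0 Om0 P0 Z W hT ab0 fc fd fpc
    ZWg ZWc XZW c0 abc).
exact: (embedded_limit_covariance dn Om P T Xd a b f fp c d0 Om0 P0 Z W hT hX ab0 fc fd fpc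
  ZWg ZWc XZW c0 abc).
Qed.
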